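(* $\mathbb{Z}/2[[X,Y]]$ acts faithfully on $W5$, where $X$ and $Y$ act by $T_7$ and $T_{13}$.
   Context: For an odd prime $p$, $T_p:\mathbb{Z}/2[[x]]\to\mathbb{Z}/2[[x]]$ is the map $\sum c_nx^n\mapsto\sum c_{pn}x^n+\sum c_nx^{pn}$. Let $D=\sum_{n>0,\ \gcd(n,6)=1}x^{n^2}$ and let $W5$ be the $\mathbb{Z}/2$-span of the $D^k$ with $k>0$, $k\equiv5\pmod 6$. $T_7$ and $T_{13}$ map each $D^{6m+5}$ to a sum of $D^{6r+5}$ with $r<m$, so $W5$ is a $\mathbb{Z}/2[[X,Y]]$-module with $X$ acting as $T_7$ and $Y$ as $T_{13}$. *)

(* Defs.v *)
From HB Require Import structures.
From mathcomp Require Import all_boot all_algebra.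
From mathcomp Require Import boolp classical_sets fsbigop.

Set Implicit Arguments.
Unset Strict Implicit.
Unset Printing Implicit Defensive.

Import GRing.Theory.
Local Open Scope ring_scope.

(** * Formal power series in one variable over a commutative ring *)

Record fps (R : Type) := Fps { coefs :> nat -> R }.
Arguments Fps {R} coefs.

Lemma fps_ext (R : Type) (f g : fps R) : (forall n, f n = g n) -> f = g.
Proof. by case: f g => [f] [g] /= fg; congr Fps; apply/funext. Qed.

HB.instance Definition _ (R : Type) := gen_eqMixin (fps R).
HB.instance Definition _ (R : Type) := gen_choiceMixin (fps R).

Section FpsRing.
Variable R : comNzRingType.
Implicit Types f g h : fps R.

Definition fps_zero : fps R := Fps (fun _ => 0).
Definition fps_opp f : fps R := Fps (fun n => - f n).
Definition fps_add f g : fps R := Fps (fun n => f n + g n).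

Fact fps_addA : associative fps_add.
Proof. by move=> f g h; apply: fps_ext => n /=; rewrite addrA. Qed.
Fact fps_addC : commutative fps_add.
Proof. by move=> f g; apply: fps_ext => n /=; rewrite addrC. Qed.
Fact fps_add0 : left_id fps_zero fps_add.
Proof. by move=> f; apply: fps_ext => n /=; rewrite add0r. Qed.
Fact fps_addN : left_inverse fps_zero fps_opp fps_add.
Proof. by move=> f; apply: fps_ext => n /=; rewrite addNr. Qed.

HB.instance Definition _ :=
  GRing.isZmodule.Build (fps R) fps_addA fps_addC fps_add0 fps_addN.

Definition fps_one : fps R := Fps (fun n => (n == 0%N)%:R).
Definition fps_mul f g : fps R :=
  Fps (fun n => \sum_(i < n.+1) f i * g (n - i)%N).

Definition fps_trunc N f : {poly R} := \poly_(i < N) f i.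

Lemma coef_trunc_mul N f g n : (n < N)%N ->
  (fps_trunc N f * fps_trunc N g)`_n = fps_mul f g n.
Proof.
move=> nN; rewrite coefM /=; apply: eq_bigr => i _; rewrite !coef_poly.
by rewrite (leq_ltn_trans (leq_ord i) nN) (leq_ltn_trans (leq_subr i n) nN).
Qed.

Fact fps_mulC : commutative fps_mul.
Proof.
by move=> f g; apply: fps_ext => n; rewrite -!(@coef_trunc_mul n.+1) // mulrC.
Qed.

Fact fps_mulA : associative fps_mul.
Proof.
move=> f g h; apply: fps_ext => n.
transitivity (fps_trunc n.+1 f * (fps_trunc n.+1 g * fps_trunc n.+1 h))`_n.
  rewrite coefM /=; apply: eq_bigr => i _.
  rewrite coef_poly ltn_ord (@coef_trunc_mul n.+1 g h) //.
  by rewrite ltnS leq_subr.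
rewrite mulrA coefM /=; apply: eq_bigr => i _.
by rewrite coef_trunc_mul ?ltn_ord // coef_poly ltnS leq_subr.
Qed.

Fact fps_mul1 : left_id fps_one fps_mul.
Proof.
move=> f; apply: fps_ext => n /=.
rewrite big_ord_recl /= mul1r subn0 big1 ?addr0 // => i _.
by rewrite mul0r.
Qed.

Fact fps_mulDl : left_distributive fps_mul fps_add.
Proof.
move=> f g h; apply: fps_ext => n /=.
by rewrite -big_split; apply: eq_bigr => i _; rewrite mulrDl.
Qed.

Fact fps_one_neq0 : fps_one != 0.
Proof.
apply/eqP => e; have /eqP := congr1 (fun f : fps R => f 0%N) e.
by rewrite /= oner_eq0.
Qed.

HB.instance Definition _ := GRing.Zmodule_isComNzRing.Build (fps R)
  fps_mulA fps_mulC fps_mul1 fps_mulDl fps_one_neq0.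

Definition fps_scale (a : R) f : fps R := Fps (fun n => a * f n).

Fact fps_scaleA a b f : fps_scale a (fps_scale b f) = fps_scale (a * b) f.
Proof. by apply: fps_ext => n /=; rewrite mulrA. Qed.
Fact fps_scale1 : left_id 1 fps_scale.
Proof. by move=> f; apply: fps_ext => n /=; rewrite mul1r. Qed.
Fact fps_scaleDr : right_distributive fps_scale +%R.
Proof. by move=> a f g; apply: fps_ext => n /=; rewrite mulrDr. Qed.
Fact fps_scaleDl f : {morph fps_scale^~ f : a b / a + b}.
Proof. by move=> a b; apply: fps_ext => n /=; rewrite mulrDl. Qed.

HB.instance Definition _ := GRing.Zmodule_isLmodule.Build R (fps R)
  fps_scaleA fps_scale1 fps_scaleDr fps_scaleDl.

End FpsRing.

(** * The operators [T_p], the series [D] and the space [W5] *)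

Definition T (p : nat) (f : fps 'F_2) : fps 'F_2 :=
  Fps (fun n => f (p * n)%N + (if (p %| n)%N then f (n %/ p)%N else 0)).

(* The coefficient of x^m in the sum of the x^(n^2); n^2 = m forces n <= m. *)
Definition D : fps 'F_2 :=
  Fps (fun m => \sum_(n < m.+1 | [&& 0 < n, gcdn n 6 == 1 & n ^ 2 == m]%N) 1).

Definition W5 : set (fps 'F_2) :=
  [set w | exists (N : nat) (c : nat -> 'F_2),
     w = \sum_(k < N | (0 < k)%N && (k == 5 %[mod 6])%N) c k *: D ^+ k].

(** * The action of Z/2[[X,Y]] *)

(* Z/2[[X,Y]] is represented as Z/2[[Y]][[X]]: the coefficient of X^i Y^j in
   u is u i j. *)
Definition fps2 := fps (fps 'F_2).

(* The action of sum u_ij X^i Y^j with X acting as T_7 and Y as T_13. For w in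
   W5, T_7 and T_13 lower the degree in D, so that only finitely many terms of
   the sum are nonzero; outside of that case the big operator returns 0. *)
Definition act (u : fps2) (w : fps 'F_2) : fps 'F_2 :=
  \sum_(ij \in [set: nat * nat])
    u ij.1 ij.2 *: iter ij.1 (T 7) (iter ij.2 (T 13) w).

(* Main.v *)
(** Write [F] for the sum of the [x^(n^2)] over the odd [n > 0] and [f(x^k)] for
    substitution. Multiplication by the units of Z[(1+sqrt(-3))/2] pairs off the
    representations [N = m^2 + 3 n^2] with [m], [n] odd and gives
    [F F(x^3) = F^4 + F(x^3)^4]; hence [D = F + F(x^9)] satisfies [D^3 = F(x^3)].
    A series [x^p + ...] satisfying that relation is [F(x^p)]. For [p = 7, 13]
    let [s] be the series with [F = s / P(s)], where [P(s)] is [(1+s+s^2)^4],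
    resp. [(1+s)^6 (1+s+s^2)^4]. The relation between [F] and [F(x^3)] forces a
    relation of bidegree (4, 4) between [s] and [s(x^3)] that is invariant under
    [s -> 1/s], so [F s^(p-1)] also satisfies it and equals [F(x^p)]. This yields
    the modular equations between [D] and [D(x^p)], thus a linear recursion for
    [T_p (D^(6n+5))], i.e. a rational generating function mod 2 for its
    coefficients [G n m].

    Coefficients of a rational function mod 2 are computed by a finite automaton
    reading the binary digits of [n] and [m]. Let the even-indexed digits of [n]
    spell [a], the odd-indexed ones [b], and call [(a, b)] the code of [n]. The
    automaton shows that [T_7] lowers both [a + b] and [a + 2b] by at least 1,
    that [T_13] lowers them by at least 1 and 2, and that codes [(a+1, b)],
    resp. [(a, b+1)], do contribute to [(a, b)]. If [u <> 0], choose [u_ij <> 0]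
    with [i + j] minimal, then [j] minimal: on [D^(6n+5)], with [n] of code
    [(i, j)], all other terms of [u] vanish and [X^i Y^j] gives [D^5]. *)

Require Import Defs.
From mathcomp Require Import all_boot all_algebra.
From mathcomp Require Import boolp classical_sets fsbigop.
From mathcomp Require Import zify ring.

Set Implicit Arguments.
Unset Strict Implicit.
Unset Printing Implicit Defensive.

Import GRing.Theory.
Local Open Scope ring_scope.

Local Notation S := (fps 'F_2).

(** * Power series over F_2 *)

Lemma F2_addrr (a : 'F_2) : a + a = 0.
Proof. exact/(addrr_pchar2 (pchar_Fp _)). Qed.

Lemma F2_sqr (a : 'F_2) : a * a = a.
Proof. by case: a => [[|[|]]] // i; apply/val_inj. Qed.

Lemma F2_cases (a : 'F_2) : a = 0 \/ a = 1.
Proof. by case: a => [[|[|]]] // i; [left|right]; apply/val_inj. Qed.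

Lemma S_addrr (f : S) : f + f = 0.
Proof. by apply: fps_ext => n; rewrite /= F2_addrr. Qed.

Lemma S_addr_eq0 (f g : S) : f + g = 0 -> f = g.
Proof. by move=> e; rewrite -[f]addr0 -(S_addrr g) addrA e add0r. Qed.

(** In characteristic 2 the points moved by [h] cancel in pairs; comparing [enum_rank] picks one
    point from each pair. *)
Lemma sum_involution (I : finType) (P : pred I) (h : I -> I) (F : I -> 'F_2) :
  (forall i, P i -> P (h i)) -> (forall i, P i -> h (h i) = i) ->
  (forall i, P i -> F (h i) = F i) ->
  \sum_(i | P i) F i = \sum_(i | P i && (h i == i)) F i.
Proof.
move=> hP hK hF; rewrite (bigID (fun i => h i == i)) /= [X in _ + X = _](_ : _ = 0) ?addr0 //.
rewrite (bigID (fun i => (enum_rank i < enum_rank (h i))%N)) /=.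
rewrite [X in _ + X = _](_ : _ =
  \sum_(i | P i && (h i != i) && (enum_rank i < enum_rank (h i))%N) F i) ?F2_addrr //.
rewrite (reindex_onto h h) /=; last by move=> i /andP[/andP[Pi _] _]; exact: hK.
have Q i : [&& (P (h i) && (h (h i) != h i)) &&
      ~~ (enum_rank (h i) < enum_rank (h (h i)))%N & h (h i) == i]
   = P i && (h i != i) && (enum_rank i < enum_rank (h i))%N.
  have [Pi|nPi] := boolP (P i); last first.
    apply/negbTE; apply/negP => /andP[/andP[/andP[/hP Phi _] _] /eqP hi].
    by rewrite hi (negbTE nPi) in Phi.
  rewrite hP // hK // eqxx andbT /= eq_sym -leqNgt leq_eqVlt.
  case: (eqVneq (h i) i) => //= ne; rewrite orb_idl // => /eqP/val_inj/enum_rank_inj e.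
  by rewrite -e eqxx in ne.
rewrite (eq_bigl _ _ Q); apply: eq_bigr => i /andP[/andP[Pi _] _]; exact: hF.
Qed.

(** * Substitution of x^k, and extraction of the exponents divisible by k *)

Definition V (k : nat) (f : S) : S := Fps (fun n => if (k %| n)%N then f (n %/ k)%N else 0).
Definition U (k : nat) (f : S) : S := Fps (fun n => f (k * n)%N).

Lemma coefM_low (f g : S) a b : (forall i, (i < a)%N -> f i = 0) ->
  (forall i, (i < b)%N -> g i = 0) -> forall n, (n < a + b)%N -> (f * g) n = 0.
Proof.
move=> fa gb n nab; rewrite /= big1 // => i _.
case: (ltnP i a) => ia; first by rewrite fa // mul0r.
by rewrite gb ?mulr0 //; move: (ltn_ord i); lia.
Qed.

Lemma coefM_lead (f g : S) a b : (forall i, (i < a)%N -> f i = 0) ->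
  (forall i, (i < b)%N -> g i = 0) -> (f * g) (a + b)%N = f a * g b.
Proof.
move=> fa gb; have ab : (a < (a + b).+1)%N by lia.
rewrite /= (bigD1 (Ordinal ab)) //= addKn big1 ?addr0 // => i ne.
case: (ltnP i a) => ia; first by rewrite fa // mul0r.
rewrite gb ?mulr0 //; have : nat_of_ord i <> a by move=> e; case/eqP: ne; apply: val_inj.
by move: (ltn_ord i); lia.
Qed.

Lemma coefX_low (f : S) v k : (forall i, (i < v)%N -> f i = 0) ->
  forall i, (i < k * v)%N -> (f ^+ k) i = 0.
Proof.
move=> fl; elim: k => [//|k IH] i ik; rewrite exprS; apply: (coefM_low fl IH).
by rewrite -mulSn.
Qed.

Lemma coefX_lead (f : S) v k : (forall i, (i < v)%N -> f i = 0) -> f v = 1 ->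
  (f ^+ k) (k * v)%N = 1.
Proof.
move=> fl fv; elim: k => [//|k IH].
by rewrite exprS mulSn (coefM_lead fl (coefX_low fl)) fv IH mul1r.
Qed.

Lemma valuationP (f : S) : f <> 0 -> exists a, f a = 1 /\ forall i, (i < a)%N -> f i = 0.
Proof.
move=> nf; have ex : exists n, f n != 0.
  apply/not_existsP => e; apply: nf; apply: fps_ext => n.
  by apply/eqP; move: (e n) => /negP; rewrite negbK.
exists (ex_minn ex); case: ex_minnP => a fa amin; split.
  by case: (F2_cases (f a)) fa => -> //; rewrite eqxx.
move=> i ia; apply/eqP; rewrite -[_ == _]negbK; apply/negP => /amin; lia.
Qed.

Lemma S_mulf_eq0 (f g : S) : f * g = 0 -> f = 0 \/ g = 0.
Proof.
move=> e; case: (pselect (f = 0)) => [|/valuationP[a [fa la]]]; first by left.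
case: (pselect (g = 0)) => [|/valuationP[b [gb lb]]]; first by right.
have := coefM_lead la lb; rewrite e fa gb mul1r /= => /esym/eqP.
by rewrite oner_eq0.
Qed.

Lemma S_mulfI (c f g : S) : c <> 0 -> c * f = c * g -> f = g.
Proof.
move=> nc e; have /S_mulf_eq0[//|/S_addr_eq0] : c * (f + g) = 0 by rewrite mulrDr e S_addrr.
by [].
Qed.

Lemma coefVM k (f g : S) n r : (r < k)%N ->
  (V k f * g) (k * n + r)%N = \sum_(i < n.+1) f i * g (k * (n - i) + r)%N.
Proof.
move=> rk; rewrite /= (bigID (fun i : 'I_(k * n + r).+1 => (k %| i)%N)) /= addrC.
rewrite big1 ?add0r => [|i /negbTE->]; last by rewrite mul0r.
have k0 : (0 < k)%N by lia.
have b (i : 'I_n.+1) : (k * i < (k * n + r).+1)%N.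
  have := leq_mul (leqnn k) (leq_ord i); lia.
rewrite (reindex_onto (fun i : 'I_n.+1 => Ordinal (b i))
   (fun i : 'I_(k * n + r).+1 => inord (i %/ k))) /=; last first.
  move=> i ki; apply: val_inj; rewrite /= inordK.
    by rewrite mulnC divnK.
  rewrite ltnS (leq_trans (leq_div2r k (leq_ord i))) //.
  by rewrite mulnC divnMDl // (divn_small rk) addn0.
apply: eq_big => [i|i _].
  rewrite dvdn_mulr //=; apply/eqP; apply: val_inj.
  by rewrite /= mulKn // inordK.
rewrite dvdn_mulr // mulKn //; congr (_ * g _).
have := leq_mul (leqnn k) (leq_ord i); rewrite mulnBr; lia.
Qed.

Lemma coefV_mul k (f : S) n : (0 < k)%N -> V k f (k * n)%N = f n.
Proof. by move=> k0; rewrite /= dvdn_mulr // mulKn. Qed.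

Lemma coefV_add k (f : S) n r : (0 < r < k)%N -> V k f (k * n + r)%N = 0.
Proof.
move=> rk; rewrite /= ifN // /dvdn mulnC modnMDl modn_small; lia.
Qed.

Lemma fps_ext_mod k (f g : S) : (0 < k)%N ->
  (forall n r, (r < k)%N -> f (k * n + r)%N = g (k * n + r)%N) -> f = g.
Proof.
move=> k0 fg; apply: fps_ext => n; rewrite (divn_eq n k) mulnC; apply: fg.
by rewrite ltn_mod.
Qed.

Lemma VM k (f g : S) : (0 < k)%N -> V k (f * g) = V k f * V k g.
Proof.
move=> k0; apply: (@fps_ext_mod k) => // n r rk; rewrite coefVM //.
case: (posnP r) => [->|r0].
  rewrite addn0 coefV_mul //; apply: eq_bigr => i _.
  by rewrite addn0 coefV_mul.
rewrite coefV_add ?r0 // big1 // => i _; rewrite coefV_add ?mulr0 //.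
by rewrite r0.
Qed.

(** [U k] is linear over series in x^k. This carries modular equations through [U] and so yields
    recursions for [T p]. *)
Lemma UVM k (f g : S) : (0 < k)%N -> U k (V k f * g) = f * U k g.
Proof.
move=> k0; apply: fps_ext => n; rewrite /U [LHS]/=.
have := coefVM f g n k0; rewrite addn0 /= => ->; apply: eq_bigr => i _.
by rewrite addn0.
Qed.

Lemma VD k (f g : S) : V k (f + g) = V k f + V k g.
Proof. by apply: fps_ext => n /=; case: ifP => _; rewrite ?addr0. Qed.

Lemma V1 k : (0 < k)%N -> V k 1 = 1.
Proof.
move=> k0; apply: fps_ext => n /=; case: ifP => [/dvdnP[m ->]|].
  by rewrite mulnK // muln_eq0 (gtn_eqF k0) orbF.
by case: n => //; rewrite dvdn0.
Qed.

Lemma VX k (f : S) n : (0 < k)%N -> V k (f ^+ n) = V k f ^+ n.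
Proof. by move=> k0; elim: n => [|n IH]; rewrite ?V1 // !exprS VM // IH. Qed.

Lemma VV k l (f : S) : (0 < k)%N -> (0 < l)%N -> V k (V l f) = V (k * l) f.
Proof.
move=> k0 l0; apply: fps_ext => n /=.
have [/dvdnP[m ->]|nk] := boolP (k %| n)%N.
  by rewrite mulnK // (mulnC k l) dvdn_pmul2r // divnMr.
by rewrite ifN //; apply: contra nk => /(dvdn_trans _); apply; exact: dvdn_mulr.
Qed.

Lemma UD k (f g : S) : U k (f + g) = U k f + U k g.
Proof. exact: fps_ext. Qed.

Lemma TE p (f : S) : T p f = U p f + V p f.
Proof. exact: fps_ext. Qed.

Lemma TD p (f g : S) : T p (f + g) = T p f + T p g.
Proof. by rewrite !TE UD VD addrACA. Qed.

Lemma T0 p : T p 0 = 0.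
Proof. by apply: fps_ext => n /=; case: ifP; rewrite addr0. Qed.

Lemma S_sqr (f : S) : f ^+ 2 = V 2 f.
Proof.
apply: fps_ext => n; rewrite expr2 [LHS]/=.
rewrite (@sum_involution _ _ (fun i => rev_ord i)) => [||i _|i _] //; last 2 first.
- exact: rev_ordK.
- by rewrite /= mulrC; congr (f _ * f _); move: (ltn_ord i); lia.
rewrite [RHS]/=; case: ifP => [/dvdnP[m ->]|nd]; last first.
  rewrite big_pred0 // => i; apply/negbTE/negP => /andP[_ /eqP/(congr1 val) /=].
  by move: (ltn_ord i) nd; lia.
have mm : (m < (m * 2).+1)%N by lia.
rewrite mulnK // (big_pred1 (Ordinal mm)) /=.
  by rewrite -[RHS]F2_sqr; congr (_ * f _); lia.
move=> i; apply/eqP/eqP => [/(congr1 val)|->]; last apply: val_inj; rewrite /=.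
  by move: (ltn_ord i) => lti e; apply: val_inj => /=; lia.
lia.
Qed.

Lemma T_sqr p (f : S) : odd p -> T p (f ^+ 2) = T p f ^+ 2.
Proof.
move=> op; rewrite (S_sqr f) (S_sqr (T p f)) (TE p f) VD TE.
have p0 : (0 < p)%N by case: p op.
congr (_ + _); last by rewrite VV // VV // mulnC.
apply: fps_ext => n /=; rewrite Gauss_dvdr; last by rewrite coprime2n.
by case: ifP => // /dvdnP[m ->]; rewrite mulnA !mulnK.
Qed.

Lemma S_sqrD (f g : S) : (f + g) ^+ 2 = f ^+ 2 + g ^+ 2.
Proof. by rewrite !S_sqr VD. Qed.

(** * Theta series and the relation between F and F(x^3) *)

Definition theta (A : pred nat) : S :=
  Fps (fun m => \sum_(n < m.+1 | A n && (n ^ 2 == m)%N) 1).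

Lemma coefV_theta A k m B : (0 < k)%N -> (m < B)%N ->
  V k (theta A) m = \sum_(n < B) (A n && (k * n ^ 2 == m)%N)%:R.
Proof.
move=> k0 mB; rewrite [RHS](eq_bigr (fun n : 'I_B =>
  if A n && (k * n ^ 2 == m)%N then 1 else 0)); last first.
  by move=> n _; case: (_ && _).
rewrite -big_mkcond /=; case: ifP => [/dvdnP[q qm]|nd]; last first.
  rewrite big_pred0 // => i; apply/negbTE/negP => /andP[_ /eqP e].
  by rewrite -e dvdn_mulr in nd.
have q1 : (q < B)%N by apply: leq_ltn_trans mB; rewrite qm; nia.
rewrite qm mulnK // (big_ord_widen_cond B (fun n => A n && (n ^ 2 == q)%N) (fun=> 1) q1) /=.
apply: eq_bigl => i; rewrite mulnC eqn_pmul2r // -andbA; congr (_ && _).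
by case: eqP => //= e; rewrite ltnS -e; nia.
Qed.

Lemma coefVV_theta A A' k k' N : (0 < k)%N -> (0 < k')%N ->
  (V k (theta A) * V k' (theta A')) N =
  \sum_(p : 'I_N.+1 * 'I_N.+1 | [&& A p.1, A' p.2 & (k * p.1 ^ 2 + k' * p.2 ^ 2 == N)%N]) 1.
Proof.
move=> k0 k'0; rewrite [LHS]/=.
transitivity (\sum_(i < N.+1) \sum_(m < N.+1) \sum_(n < N.+1)
   ([&& A m, A' n & (k * m ^ 2 == i)%N && (k' * n ^ 2 == N - i)%N]%:R : 'F_2)).
  apply: eq_bigr => i _; have := @coefV_theta A k i N.+1 k0 (ltn_ord i).
  have iN : (N - i < N.+1)%N by rewrite ltnS leq_subr.
  have := @coefV_theta A' k' (N - i)%N N.+1 k'0 iN; rewrite /= => -> ->.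
  rewrite big_distrlr /=; apply: eq_bigr => m _; apply: eq_bigr => n _.
  by rewrite -natrM mulnb andbACA -andbA.
rewrite exchange_big /= [RHS]big_mkcond /= -(pair_bigA _ (fun m n : 'I_N.+1 =>
  if [&& A m, A' n & (k * m ^ 2 + k' * n ^ 2 == N)%N] then 1 else 0)) /=.
apply: eq_bigr => m _; rewrite exchange_big; apply: eq_bigr => n _.
case: (A m); last by rewrite big1.
case: (A' n); last by rewrite big1.
rewrite /=; case: ifP => [/eqP e|ne].
  have mN : (k * m ^ 2 < N.+1)%N by lia.
  have e2 : (k' * n ^ 2 == N - k * m ^ 2)%N by lia.
  rewrite (bigD1 (Ordinal mN)) //= eqxx e2 big1 ?addr0 // => i ni.
  case: eqP => //= e'; case/eqP: ni; exact/val_inj/esym.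
by rewrite big1 // => i _; case: eqP => //= e; case: eqP => //= e'; move: ne (ltn_ord i); lia.
Qed.

Definition Fth : S := theta odd.

(* Multiplication of (m + n sqrt(-3))/2, up to signs, by the primitive sixth
   root of unity that keeps m and n odd. *)
Definition eis_turn (p : nat * nat) : nat * nat :=
  let: (m, n) := p in
  if odd ((m + n)./2) then ((m - 3 * n + (3 * n - m))./2, (m + n)./2)
  else ((m + 3 * n)./2, (m - n + (n - m))./2).

Arguments eis_turn : simpl never.

(** Units have norm 1, so the form is kept. Exactly one of (m + n)/2 and (m - n)/2 is odd, and the
    parity test picks the unit accordingly. The sums of two opposite truncated differences are
    absolute values. *)
Lemma eis_turnP (m n : nat) : odd m -> odd n ->
  let: (m', n') := eis_turn (m, n) in
  [/\ odd m', odd n', (m' ^ 2 + 3 * n' ^ 2 = m ^ 2 + 3 * n ^ 2)%N & eis_turn (m', n') = (m, n)].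
Proof.
move=> om on; rewrite /eis_turn; case: ifP => o1.
  split; [lia|lia| |by case: ifP => o2; congr pair; lia].
  set a := (m - 3 * n + (3 * n - m))./2; set b := (m + n)./2.
  have b2 : (m + n = 2 * b)%N by rewrite /b; lia.
  case: (leqP m (3 * n)) => h.
    have a2 : (a + b = 2 * n)%N by rewrite /a /b; lia.
    nia.
  have a2 : (b = 2 * n + a)%N by rewrite /a /b; lia.
  nia.
split; [lia|lia| |by case: ifP => o2; congr pair; lia].
set a := (m + 3 * n)./2; set b := (m - n + (n - m))./2.
case: (leqP m n) => h.
  have e1 : (a = 2 * n - b)%N by rewrite /a /b; lia.
  have e2 : (n = m + 2 * b)%N by rewrite /b; lia.
  nia.
have e1 : (a = 2 * n + b)%N by rewrite /a /b; lia.
have e2 : (m = n + 2 * b)%N by rewrite /b; lia.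
nia.
Qed.

Lemma Fth_rel : Fth * V 3 Fth = Fth ^+ 4 + V 3 Fth ^+ 4.
Proof.
have X4 (f : S) : f ^+ 4 = V 4 f by rewrite -[4%N]/(2 * 2)%N exprM !S_sqr VV.
rewrite !X4 VV //; apply: fps_ext => N.
have := @coefVV_theta odd odd 1 3 N isT isT.
have -> : V 1 (theta odd) = Fth by apply: fps_ext => n /=; rewrite dvd1n divn1.
move=> ->.
pose h (p : 'I_N.+1 * 'I_N.+1) : 'I_N.+1 * 'I_N.+1 :=
  let q := eis_turn (val p.1, val p.2) in (inord q.1, inord q.2).
pose P (p : 'I_N.+1 * 'I_N.+1) := [&& odd p.1, odd p.2 & (1 * p.1 ^ 2 + 3 * p.2 ^ 2 == N)%N].
have hE p : P p -> [/\ P (h p), val (h p).1 = (eis_turn (val p.1, val p.2)).1,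
   val (h p).2 = (eis_turn (val p.1, val p.2)).2 &
   eis_turn (eis_turn (val p.1, val p.2)) = (val p.1, val p.2)].
  case: p => m n /and3P[/= om on /eqP mn]; have := eis_turnP om on.
  rewrite /P /h /=; case: (eis_turn _) => m' n' [om' on' e ->].
  have sq k : (k <= k ^ 2)%N by case: k => // k; rewrite expnS expn1 leq_pmulr.
  have mn' : (1 * m' ^ 2 + 3 * n' ^ 2 == N)%N by apply/eqP; rewrite mul1n e -[RHS]mn mul1n.
  have [m'N n'N] : (m' < N.+1)%N /\ (n' < N.+1)%N.
    have := (sq m', sq n'); case; move: mn'; rewrite mul1n.
    by move: (m' ^ 2)%N (n' ^ 2)%N => a b; lia.
  by rewrite !inordK // om' on' mn'.
have hP p : P p -> P (h p) by case/hE.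
have hK p : P p -> h (h p) = p.
  case/hE => _ e1 e2 e; rewrite {1}/h e1 e2 -surjective_pairing e /=.
  by case: p {e1 e2 e} => m n; rewrite !inord_val.
rewrite (@sum_involution _ P h _ hP hK) //.
(* The fixed pairs m = n and m = 3n represent 4n^2 and 12n^2; they account for the two fourth
   powers. *)
have fixE p : P p -> (h p == p) = (val p.1 == val p.2) || (val p.1 == 3 * val p.2)%N.
  move=> Pp; have [_ e1 e2 _] := hE p Pp; case/and3P: Pp => om on _.
  rewrite -pair_eqE /pair_eq -!val_eqE /= e1 e2; move: om on; rewrite /eis_turn.
  by case: ifP => /=; lia.
rewrite (eq_bigl (fun p =>
  P p && ((val p.1 == val p.2) || (val p.1 == 3 * val p.2)%N))); last first.
  by move=> p; case: (boolP (P p)) => //= /fixE.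
have -> : (V 4 Fth + V (3 * 4) Fth) N = V 4 Fth N + V 12 Fth N by [].
have /= coefB k : (0 < k)%N -> V k Fth N = \sum_(n < N.+1 | odd n && (k * n ^ 2 == N)%N) 1.
  move=> k0; rewrite (@coefV_theta odd k N N.+1) // [RHS]big_mkcond.
  by apply: eq_bigr => n _; case: (_ && _).
rewrite !coefB // (bigID (fun p => val p.1 == val p.2)) /=; congr (_ + _).
  rewrite (reindex_onto (fun n : 'I_N.+1 => (n, n)) fst) /=; last first.
    by case=> m n /andP[_ /eqP/val_inj /= ->].
  apply: eq_bigl => n; rewrite /P /= !eqxx !andbT mul1n -mulSn.
  by case: (odd n).
rewrite (reindex_onto (fun n : 'I_N.+1 => (inord (3 * n), n)) snd) /=; last first.
  case=> m n /andP[/andP[_ /orP[->//|/eqP e]] _] /=.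
  by congr pair; apply: val_inj; rewrite /= inordK -e.
apply: eq_bigl => n; rewrite /P /=; case: (ltnP (3 * n) N.+1) => n3.
  rewrite inordK // !eqxx orbT !andbT mul1n oddM /= -andbA.
  case: (boolP (odd n)) => //= on; apply/idP/idP; first by case/andP; lia.
  by move=> e; apply/andP; split; lia.
apply/idP/idP; last by case/andP => on /eqP; nia.
case/andP => /andP[/andP[/and3P[_ on _] /orP[->//|/eqP e]] _] _.
by move: (ltn_ord (inord (3 * n) : 'I_N.+1)); rewrite e ltnNge n3.
Qed.

(** * Reflection for polynomial identities in characteristic 2 *)

(** A list of bits is a polynomial over F_2 in one variable, constant term first. In a list of such
    lists the outer index is the exponent of x, the inner one that of y. *)
Fixpoint add1 (a b : seq bool) : seq bool :=
  match a, b with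
  | x :: a', y :: b' => (x (+) y) :: add1 a' b'
  | [::], _ => b
  | _, [::] => a
  end.

Fixpoint mul1 (a b : seq bool) : seq bool :=
  if a is x :: a' then add1 (if x then b else [::]) (false :: mul1 a' b) else [::].

Fixpoint add2 (a b : seq (seq bool)) : seq (seq bool) :=
  match a, b with
  | x :: a', y :: b' => add1 x y :: add2 a' b'
  | [::], _ => b
  | _, [::] => a
  end.

Fixpoint mul2 (a b : seq (seq bool)) : seq (seq bool) :=
  if a is x :: a' then add2 (map (mul1 x) b) ([::] :: mul2 a' b) else [::].

(** Trailing zeros make the representation non-unique, so equality is tested as vanishing of the
    sum. *)
Definition zero1 : pred (seq bool) := all negb.
Definition zero2 : pred (seq (seq bool)) := all zero1.

Definition ev1 (y : S) (l : seq bool) : S := foldr (fun (b : bool) (f : S) => b%:R + y * f) 0 l.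
Definition ev2 (x y : S) (l : seq (seq bool)) : S := foldr (fun r (f : S) => ev1 y r + x * f) 0 l.

Lemma natr_addb (a b : bool) : (a (+) b)%:R = a%:R + b%:R :> S.
Proof. by case: a; case: b; rewrite ?addr0 ?add0r //= S_addrr. Qed.

Lemma ev1_add y a b : ev1 y (add1 a b) = ev1 y a + ev1 y b.
Proof.
elim: a b => [|x a IH] [|z b] //=; rewrite ?addr0 ?add0r // IH natr_addb mulrDr.
by rewrite addrACA.
Qed.

Lemma ev1_mul y a b : ev1 y (mul1 a b) = ev1 y a * ev1 y b.
Proof.
elim: a => [|x a IH]; first by rewrite mul0r.
rewrite [mul1 _ _]/= ev1_add /= add0r IH mulrDl mulrA; congr (_ + _).
by case: x; rewrite ?mul1r ?mul0r.
Qed.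

Lemma ev1_zero y a : zero1 a -> ev1 y a = 0.
Proof. by elim: a => [|[] a IH] //= /IH ->; rewrite mulr0 addr0. Qed.

Lemma ev2_add x y a b : ev2 x y (add2 a b) = ev2 x y a + ev2 x y b.
Proof.
elim: a b => [|r a IH] [|z b] //=; rewrite ?addr0 ?add0r // IH ev1_add mulrDr.
by rewrite addrACA.
Qed.

Lemma ev2_mul x y a b : ev2 x y (mul2 a b) = ev2 x y a * ev2 x y b.
Proof.
elim: a => [|r a IH]; first by rewrite mul0r.
rewrite [mul2 _ _]/= ev2_add /= add0r IH mulrDl mulrA; congr (_ + _).
elim: b {IH} => [|z b IH] /=; first by rewrite mulr0.
by rewrite IH ev1_mul mulrDr mulrCA.
Qed.

Lemma ev2_eq x y a b : zero2 (add2 a b) -> ev2 x y a = ev2 x y b.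
Proof.
move=> z; apply: S_addr_eq0; rewrite -ev2_add; elim: (add2 a b) z => //= r l IH.
by case/andP => /ev1_zero -> /IH ->; rewrite mulr0 addr0.
Qed.

Inductive pexp := PX | PY | POne | PAdd of pexp & pexp | PMul of pexp & pexp | PPow of pexp & nat.

Fixpoint peval (x y : S) (e : pexp) : S :=
  match e with
  | PX => x | PY => y | POne => 1
  | PAdd a b => peval x y a + peval x y b
  | PMul a b => peval x y a * peval x y b
  | PPow a n => peval x y a ^+ n
  end.

Fixpoint pnorm (e : pexp) : seq (seq bool) :=
  match e with
  | PX => [:: [::]; [:: true]] | PY => [:: [:: false; true]] | POne => [:: [:: true]]
  | PAdd a b => add2 (pnorm a) (pnorm b)
  | PMul a b => mul2 (pnorm a) (pnorm b)
  | PPow a n => iter n (mul2 (pnorm a)) [:: [:: true]]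
  end.

Lemma ev2_pnorm x y e : ev2 x y (pnorm e) = peval x y e.
Proof.
elim: e => /= [|||a IHa b IHb|a IHa b IHb|a IHa n]; rewrite ?mulr0 ?addr0 ?add0r ?mulr1 //.
- by rewrite ev2_add IHa IHb.
- by rewrite ev2_mul IHa IHb.
elim: n => [|n IH]; first by rewrite /= !mulr0 !addr0.
by rewrite iterS ev2_mul IHa IH exprS.
Qed.

Lemma peval_eq x y e1 e2 : zero2 (add2 (pnorm e1) (pnorm e2)) -> peval x y e1 = peval x y e2.
Proof. by move=> z; rewrite -!ev2_pnorm; exact: ev2_eq. Qed.

(* Division in F_2[y][x] by a monic divisor: rows are listed from the leading
   one on, and b omits the leading row of the divisor. *)
Fixpoint quo_rec n (a b : seq (seq bool)) : seq (seq bool) :=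
  if n is n'.+1 then
    head [::] a :: quo_rec n' (add2 (behead a) (map (mul1 (head [::] a)) b)) b
  else [::].

Definition quo (a b : seq (seq bool)) : seq (seq bool) :=
  rev (quo_rec (size a - (size b).-1) (rev a) (behead (rev b))).

(** Nothing is proved about [quo]; the candidate quotient is certified by multiplying back. *)
Lemma peval_dvd x y a b (q := quo (pnorm a) (pnorm b)) :
  zero2 (add2 (pnorm a) (mul2 (pnorm b) q)) -> peval x y a = peval x y b * ev2 x y q.
Proof. by move=> z; rewrite -!ev2_pnorm -ev2_mul; exact: ev2_eq. Qed.

Lemma ev2_coef0 (x y : S) l : x 0%N = 0 -> y 0%N = 0 ->
  (ev2 x y l) 0%N = (nth false (nth [::] l 0) 0)%:R.
Proof.
move=> x0 y0; case: l => [|[|b r] l] //=;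
  rewrite ?big_ord_recl ?big_ord0 ?x0 ?y0 ?mul0r ?add0r ?addr0 //.
by case: b.
Qed.

Ltac reify x y t :=
  lazymatch t with
  | x => constr:(PX)
  | y => constr:(PY)
  | 1%R => constr:(POne)
  | (?a + ?b)%R => let u := reify x y a in let v := reify x y b in constr:(PAdd u v)
  | (?a * ?b)%R => let u := reify x y a in let v := reify x y b in constr:(PMul u v)
  | (?a ^+ ?n)%R => let u := reify x y a in constr:(PPow u n)
  end.

Ltac char2 x y :=
  lazymatch goal with
  | |- ?a = ?b => let u := reify x y a in let v := reify x y b in
     exact (@peval_eq x y u v ltac:(vm_compute; reflexivity))
  end.

(** * The cube of D, and parametrized modular equations *)

Lemma Fth_low n : (n < 1)%N -> Fth n = 0.
Proof. by case: n => //= _; rewrite big_pred0 // => i; rewrite ord1. Qed.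

Lemma Fth1 : Fth 1%N = 1.
Proof.
rewrite /= big_mkcond !big_ord_recl big_ord0 /= ?addr0 ?add0r //.
Qed.

Lemma S_neq0 (f : S) n : f n = 1 -> f <> 0.
Proof. by move=> e f0; move: e; rewrite f0 /= => /esym/eqP; rewrite oner_eq0. Qed.

Lemma V_low k (f : S) a : (0 < k)%N -> (forall i, (i < a)%N -> f i = 0) ->
  forall i, (i < k * a)%N -> V k f i = 0.
Proof.
move=> k0 fa i ik /=; case: ifP => // /dvdnP[j e]; rewrite e mulnK //; apply: fa.
by move: ik; rewrite e mulnC ltn_pmul2l.
Qed.

Lemma D_theta : D = theta (fun n => (0 < n)%N && (gcdn n 6 == 1)%N).
Proof. by apply: fps_ext => m /=; apply: eq_bigl => n; rewrite andbA. Qed.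

Lemma S_pow4 (f : S) : f ^+ 4 = V 4 f.
Proof. by rewrite -[4%N]/(2 * 2)%N exprM !S_sqr VV. Qed.

(** Among the odd n, those divisible by 3 are n = 3k with k odd and contribute x^(9k^2); in
    characteristic 2 adding these terms removes them. *)
Lemma D_Fth : D = Fth + V 9 Fth.
Proof.
apply: fps_ext => N; have V1E (f : S) : f = V 1 f.
  by apply: fps_ext => n /=; rewrite dvd1n divn1.
rewrite D_theta.
transitivity (V 1 Fth N + V 9 Fth N); last by rewrite -V1E.
rewrite [theta _]V1E.
have N1 : (N < N.+1 * 3)%N by lia.
rewrite !(@coefV_theta _ 1 N (N.+1 * 3)) // (@coefV_theta _ 9 N N.+1) //.
rewrite [X in _ = X + _](bigID (fun n : 'I_(N.+1 * 3) => (3 %| n)%N)) /= addrAC.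
rewrite [X in _ = X + _ + _](_ : _ = \sum_(n < N.+1) (odd n && (9 * n ^ 2 == N)%N)%:R).
  rewrite F2_addrr add0r [RHS]big_mkcond /=; apply: eq_bigr => n _.
  have -> : (0 < n)%N && (gcdn n 6 == 1)%N = odd n && ~~ (3 %| n)%N.
    have -> : (gcdn n 6 == 1)%N = coprime n (2 * 3) by [].
    rewrite coprimeMr coprimen2 (coprime_sym n 3) prime_coprime //.
    by case: (n : nat).
  by case: (3 %| n)%N; rewrite ?andbF ?andbT.
have b (n : 'I_N.+1) : (3 * n < N.+1 * 3)%N by rewrite mulnC ltn_pmul2r.
rewrite (reindex_onto (fun n : 'I_N.+1 => Ordinal (b n))
  (fun n : 'I_(N.+1 * 3) => inord (n %/ 3))) /=; last first.
  move=> n n3; apply: val_inj; rewrite /= inordK; first by rewrite mulnC divnK.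
  by rewrite ltn_divLR.
rewrite (eq_bigl xpredT) => [|n].
  apply: eq_bigr => n _; rewrite oddM /= expnMn mul1n //.
by rewrite dvdn_mulr //=; apply/eqP; apply: val_inj; rewrite /= mulKn // inordK.
Qed.

Lemma D1 : D 1%N = 1.
Proof. by rewrite D_Fth; have /= -> := Fth1; rewrite addr0. Qed.

Lemma D_low i : (i < 1)%N -> D i = 0.
Proof. by case: i => // _; rewrite /= big_pred0 // => i; rewrite ord1. Qed.

Lemma D_neq0 : D <> 0. Proof. exact: S_neq0 D1. Qed.

(* Adding the relation for [F] and its image under [V 3] gives [D^4 = V 3 F * D]. *)
Lemma D_cube : D ^+ 3 = V 3 Fth.
Proof.
have e9 : V 3 Fth * V 9 Fth = V 3 Fth ^+ 4 + V 9 Fth ^+ 4.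
  have := congr1 (V 3) Fth_rel; rewrite VM // VD !VX // VV //.
apply: (S_mulfI D_neq0); rewrite -exprS.
have -> : D ^+ 4 = Fth ^+ 4 + V 9 Fth ^+ 4 by rewrite D_Fth !S_pow4 VD.
rewrite D_Fth mulrDl Fth_rel (mulrC (V 9 Fth)) e9 addrA -(addrA (Fth ^+ 4)) S_addrr addr0.
by [].
Qed.

(* If [f + g] had valuation [v > p], then [f * V 3 (f + g) + (f + g) * V 3 g]
   would have valuation [v + 3p], and the sum of fourth powers at least [4v]. *)
Lemma rel3_unique p (f g : S) : (0 < p)%N ->
  (forall i, (i < p)%N -> f i = 0) -> (forall i, (i < p)%N -> g i = 0) ->
  f p = 1 -> g p = 1 ->
  f * V 3 f = f ^+ 4 + V 3 f ^+ 4 -> g * V 3 g = g ^+ 4 + V 3 g ^+ 4 -> f = g.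
Proof.
move=> p0 fl gl fp gp ef eg; apply: S_addr_eq0; set d := f + g.
case: (pselect (d = 0)) => // /valuationP[v [dv dl]].
have pv : (p < v)%N.
  rewrite ltnNge; apply/negP => vp; have : d v = 0; last by rewrite dv => /eqP; rewrite oner_eq0.
  move: vp; rewrite leq_eqVlt => /orP[/eqP->|vp]; last by rewrite /= fl // gl // addr0.
  by rewrite /= fp gp F2_addrr.
have e : d ^+ 4 + V 3 d ^+ 4 = f * V 3 d + d * V 3 g.
  transitivity (f * V 3 f + g * V 3 g).
    by rewrite ef eg !S_pow4 /d !VD addrACA.
  by rewrite /d VD mulrDr mulrDl addrA -(addrA (f * V 3 f)) S_addrr addr0.
have := congr1 (fun h : S => h (v + 3 * p)%N) e.
have -> : (d ^+ 4 + V 3 d ^+ 4) (v + 3 * p)%N =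
  (d ^+ 4) (v + 3 * p)%N + (V 3 d ^+ 4) (v + 3 * p)%N by [].
have -> : (f * V 3 d + d * V 3 g) (v + 3 * p)%N =
  (f * V 3 d) (v + 3 * p)%N + (d * V 3 g) (v + 3 * p)%N by [].
have d3 := @V_low 3 d v isT dl; have g3 := @V_low 3 g p isT gl.
rewrite !S_pow4 VV // (V_low _ dl) ?(V_low _ dl) //; try lia.
rewrite (coefM_low fl d3); last by lia.
by rewrite (coefM_lead dl g3) dv coefV_mul // gp mul1r addr0 add0r => /esym/eqP; rewrite oner_eq0.
Qed.

(** * Congruence modulo x^n and contractions *)

Definition eqmod n (f g : S) := forall i, (i < n)%N -> f i = g i.

Lemma eqmodD n f g f' g' : eqmod n f g -> eqmod n f' g' -> eqmod n (f + f') (g + g').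
Proof. by move=> e e' i ni /=; rewrite e ?e'. Qed.

Lemma eqmodM n f g f' g' : eqmod n f g -> eqmod n f' g' -> eqmod n (f * f') (g * g').
Proof.
move=> e e' i ni /=; apply: eq_bigr => j _; rewrite e ?e' //; move: (ltn_ord j); lia.
Qed.

Lemma eqmodX n f g k : eqmod n f g -> eqmod n (f ^+ k) (g ^+ k).
Proof.
move=> e; elim: k => [|k IH]; first by [].
by rewrite (exprS f) (exprS g); apply: eqmodM.
Qed.

Lemma eqmod_mulS n (c f g : S) : c 0%N = 0 -> eqmod n f g -> eqmod n.+1 (c * f) (c * g).
Proof.
move=> c0 e i ni /=; rewrite !big_ord_recl c0 !mul0r; congr (_ + _).
apply: eq_bigr => j _; rewrite e //= /bump /=; move: (ltn_ord j); lia.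
Qed.

(** The iterates from 0 stabilise modulo every x^n; coefficient [i] of the limit is already final in
    iterate [i.+1]. *)
Lemma contraction_fixpoint (h : S -> S) :
  (forall n f g, eqmod n f g -> eqmod n.+1 (h f) (h g)) -> exists f, f = h f.
Proof.
move=> hc; pose a n := iter n h 0.
have aS n m : (n <= m)%N -> eqmod n (a n) (a m).
  elim: n m => [|n IH] [|m] // nm; exact/hc/IH.
exists (Fps (fun i => a i.+1 i)); apply: fps_ext => i.
have e : eqmod i (Fps (fun i => a i.+1 i)) (a i) by move=> j ji; exact: (aS j.+1 i).
by rewrite (hc _ _ _ e).
Qed.

Section Modular.
Variables (p : nat) (P : S -> S) (Psi : S -> S -> S).
Hypothesis p_gt0 : (0 < p)%N.
Hypothesis VP : forall f, V 3 (P f) = P (V 3 f).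
Hypothesis eqmodP : forall n f g, eqmod n f g -> eqmod n (P f) (P g).
Hypothesis P0 : P 0 0%N = 1.
(** With [Fth = s / P s] and [t = V 3 s], the left side is the relation between [Fth] and [V 3 Fth]
    after clearing denominators. The cofactor [C] has constant term 1, so it can be cancelled. *)
Hypothesis Psi_fwd : forall s t : S, s 0%N = 0 -> t 0%N = 0 ->
  exists2 C : S, (s * P t + t * P s) ^+ 4 + s * t * (P s * P t) ^+ 3 = Psi s t * C & C 0%N = 1.
(** This is the same relation for [s ^+ p / P s], which is [Fth * s ^+ p.-1]. *)
Hypothesis Psi_bwd : forall s t : S, Psi s t = 0 ->
  (s ^+ p * P t + t ^+ p * P s) ^+ 4 = s ^+ p * t ^+ p * (P s * P t) ^+ 3.

Lemma modular_parametrization : exists s : S, s = Fth * P s /\ V p Fth = Fth * s ^+ p.-1.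
Proof.
have [s es] : exists s, s = Fth * P s.
  apply: contraction_fixpoint => n f g e; apply: eqmod_mulS (eqmodP e).
  exact: Fth_low.
exists s; split=> //.
have s0 : s 0%N = 0 by rewrite es (coefM_low (a := 1) (b := 0) Fth_low).
have Ps0 : (P s) 0%N = 1.
  by rewrite -P0; apply: (@eqmodP 1) => // -[|i].
have sl i : (i < 1)%N -> s i = 0 by case: i.
have s1 : s 1%N = 1.
  by rewrite es -[1%N]/(1 + 0)%N (coefM_lead Fth_low) // Fth1 Ps0 mul1r.
pose t := V 3 s; have et : t = V 3 Fth * P t by rewrite /t -VP -VM // -es.
have t0 : t 0%N = 0 by rewrite /t /= div0n.
have Pt0 : (P t) 0%N = 1 by rewrite -P0; apply: (@eqmodP 1) => // -[|i].
have Psi0 : Psi s t = 0.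
  have [C e C0] := Psi_fwd s0 t0; have : Psi s t * C = 0.
    rewrite -e {1}es {2}et {3}es {3}et.
    have -> : Fth * P s * P t + V 3 Fth * P t * P s = (Fth + V 3 Fth) * (P s * P t) by ring.
    have -> : Fth * P s * (V 3 Fth * P t) * (P s * P t) ^+ 3 =
      (Fth * V 3 Fth) * (P s * P t) ^+ 4 by ring.
    by rewrite exprMn Fth_rel !S_pow4 VD S_addrr.
  by case/S_mulf_eq0 => // Cz; case: (S_neq0 C0).
have PP : P s * P t <> 0.
  by case/S_mulf_eq0; [exact: S_neq0 Ps0 | exact: S_neq0 Pt0].
pose H := Fth * s ^+ p.-1.
have VH : V 3 H = V 3 Fth * t ^+ p.-1 by rewrite VM // VX.
have sp : s ^+ p = H * P s by rewrite -(prednK p_gt0) exprS {1}es /H; ring.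
have tp : t ^+ p = V 3 H * P t by rewrite VH -(prednK p_gt0) exprS {1}et; ring.
have low (k i : nat) : (i < k)%N -> (s ^+ k) i = 0.
  by move=> ik; apply: (coefX_low sl); rewrite muln1.
have lead (k : nat) : (s ^+ k) k = 1.
  by have := coefX_lead k sl s1; rewrite muln1.
(* Both [V p Fth] and [H] start with x^p and satisfy the relation, so uniqueness identifies them. *)
apply: (@rel3_unique p) => //.
- move=> i ip; have /(@V_low p) := Fth_low; move/(_ p_gt0 i); rewrite muln1; exact.
- by move=> i ip; apply: (coefM_low Fth_low (low p.-1)); lia.
- by have := coefV_mul Fth 1 p_gt0; rewrite muln1 Fth1.
- have -> : (Fth * s ^+ p.-1) p = (Fth * s ^+ p.-1) (1 + p.-1)%N by rewrite add1n prednK.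
  by rewrite (coefM_lead Fth_low (low _)) lead Fth1 mul1r.
- have := congr1 (V p) Fth_rel; rewrite VM // VD !VX // !VV // !(mulnC p); exact.
apply: (@S_mulfI ((P s * P t) ^+ 4)) => [|].
  by rewrite !exprS expr0 mulr1; do 4?[case/S_mulf_eq0 => //].
have := Psi_bwd Psi0; rewrite sp tp.
have -> : H * P s * P t + V 3 H * P t * P s = (P s * P t) * (H + V 3 H) by ring.
have -> : H * P s * (V 3 H * P t) * (P s * P t) ^+ 3 = (P s * P t) ^+ 4 * (H * V 3 H) by ring.
rewrite exprMn => <-; congr (_ * _); by rewrite !S_pow4 VD.
Qed.

End Modular.

Definition P7 (s : S) : S := (1 + s + s ^+ 2) ^+ 4.
Definition P13 (s : S) : S := (1 + s) ^+ 6 * (1 + s + s ^+ 2) ^+ 4.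
(** Here [e] and [q] stand for s + t and st. [Psi7] and [Psi13] satisfy q^4 Psi(e/q, 1/q) = Psi(e,
    q), the invariance under inverting both s and t. *)
Definition Psi7 (e q : S) : S := e ^+ 4 + q + q ^+ 2 + q ^+ 3.
Definition Psi13 (e q : S) : S := e ^+ 4 + q + q ^+ 2 + q ^+ 3 + q * e ^+ 2.
(** The product (1 + s + s^2)(1 + t + t^2) in terms of e = s + t and q = st, modulo 2. *)
Definition RR (e q : S) : S := 1 + e + e ^+ 2 + q + q * e + q ^+ 2.

Ltac char2_dvd0 x y h :=
  lazymatch type of h with
  | ?c = 0 => let v := reify x y c in
    lazymatch goal with
    | |- ?a = 0 => let u := reify x y a in
      rewrite [a](@peval_dvd x y u v ltac:(vm_compute; reflexivity)) [peval _ _ _]h mul0r //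
    end
  end.

Ltac char2_quo x y :=
  lazymatch goal with
  | |- exists2 C, ?a = ?b * C & _ =>
    let u := reify x y a in let v := reify x y b in
    exists (ev2 x y (quo (pnorm u) (pnorm v)));
      [exact (@peval_dvd x y u v ltac:(vm_compute; reflexivity)) | ]
  end.

Lemma coef0_sum_prod (s t : S) : s 0%N = 0 -> t 0%N = 0 -> (s + t) 0%N = 0 /\ (s * t) 0%N = 0.
Proof.
move=> s0 t0; split; first by rewrite /= s0 t0 addr0.
by rewrite /= big_ord_recl big_ord0 s0 mul0r addr0.
Qed.

Lemma modular_Fth7 : exists s : S, s = Fth * P7 s /\ V 7 Fth = Fth * s ^+ 6.
Proof.
apply: (@modular_parametrization 7 P7 (fun s t => Psi7 (s + t) (s * t))) => //.
- by move=> f; rewrite /P7 VX // !VD VX // V1.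
- by move=> n f g e; rewrite /P7; apply/eqmodX/eqmodD/eqmodX => //; apply: eqmodD.
- by have -> : P7 0 = 1 by rewrite /P7 expr0n !addr0 expr1n.
- move=> s t s0 t0; have [e00 q00] := coef0_sum_prod s0 t0.
  have -> : s * P7 t + t * P7 s = let e := s + t in let q := s * t in
     e + e * q ^+ 2 + e * q ^+ 4 + e ^+ 3 * q + e ^+ 5 * q ^+ 2 + e ^+ 7 * q.
    by rewrite /P7 /=; char2 s t.
  have -> : P7 s * P7 t = RR (s + t) (s * t) ^+ 4 by rewrite /P7 /RR; char2 s t.
  move: (s + t) (s * t) e00 q00 => e q e00 q00; rewrite /RR /Psi7 /=.
  char2_quo e q; rewrite ev2_coef0 //.
- move=> s t.
  have -> : s ^+ 7 * P7 t + t ^+ 7 * P7 s = let e := s + t in let q := s * t in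
     e * q ^+ 3 + e * q ^+ 5 + e * q ^+ 7 + e ^+ 3 * q ^+ 4 + e ^+ 5 * q + e ^+ 7.
    by rewrite /P7 /=; char2 s t.
  have -> : P7 s * P7 t = RR (s + t) (s * t) ^+ 4 by rewrite /P7 /RR; char2 s t.
  rewrite [X in _ = X * _](_ : _ = (s * t) ^+ 7); last by rewrite exprMn.
  move: (s + t) (s * t) => e q Psi0.
  rewrite /RR /=.
  by apply: S_addr_eq0; rewrite /Psi7 in Psi0; char2_dvd0 e q Psi0.
Qed.

Lemma modular_Fth13 : exists s : S, s = Fth * P13 s /\ V 13 Fth = Fth * s ^+ 12.
Proof.
apply: (@modular_parametrization 13 P13 (fun s t => Psi13 (s + t) (s * t))) => //.
- by move=> f; rewrite /P13 VM // !VX // !VD VX // V1.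
- move=> n f g e; rewrite /P13.
  by apply: eqmodM; apply: eqmodX; apply: eqmodD => //; [apply: eqmodD|apply: eqmodX].
- by have -> : P13 0 = 1 by rewrite /P13 expr0n !addr0 !expr1n mulr1.
- move=> s t s0 t0; have [e00 q00] := coef0_sum_prod s0 t0.
  have -> : s * P13 t + t * P13 s = let e := s + t in let q := s * t in
     e + e * q + e * q ^+ 6 + e * q ^+ 7 + e ^+ 3 * q ^+ 5 + e ^+ 3 * q ^+ 6 + e ^+ 5 * q ^+ 4
     + e ^+ 9 * q ^+ 2 + e ^+ 9 * q ^+ 3 + e ^+ 11 * q + e ^+ 11 * q ^+ 2 + e ^+ 13 * q.
    by rewrite /P13 /=; char2 s t.
  have -> : P13 s * P13 t = (1 + (s + t) + s * t) ^+ 6 * RR (s + t) (s * t) ^+ 4.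
    by rewrite /P13 /RR; char2 s t.
  move: (s + t) (s * t) e00 q00 => e q e00 q00; rewrite /RR /Psi13 /=.
  char2_quo e q; rewrite ev2_coef0 //.
- move=> s t.
  have -> : s ^+ 13 * P13 t + t ^+ 13 * P13 s = let e := s + t in let q := s * t in
     e * q ^+ 6 + e * q ^+ 7 + e * q ^+ 12 + e * q ^+ 13 + e ^+ 3 * q ^+ 5 + e ^+ 3 * q ^+ 6
     + e ^+ 5 * q ^+ 5 + e ^+ 9 * q ^+ 2 + e ^+ 9 * q ^+ 3 + e ^+ 11 * q
     + e ^+ 11 * q ^+ 2 + e ^+ 13.
    by rewrite /P13 /=; char2 s t.
  have -> : P13 s * P13 t = (1 + (s + t) + s * t) ^+ 6 * RR (s + t) (s * t) ^+ 4.
    by rewrite /P13 /RR; char2 s t.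
  rewrite [X in _ = X * _](_ : _ = (s * t) ^+ 13); last by rewrite exprMn.
  move: (s + t) (s * t) => e q Psi0.
  rewrite /RR /=.
  by apply: S_addr_eq0; rewrite /Psi13 in Psi0; char2_dvd0 e q Psi0.
Qed.

(** * Modular equations for D and recursions for T_p *)

(** The cofactor f^2 + fg + g^2 of f + g vanishes only for f = g = 0: if f has valuation a, at most
    that of g, its coefficient at x^(2a) is 1 + c + c, where c is the coefficient of g at x^a. *)
Lemma S_cube_inj (f g : S) : f ^+ 3 = g ^+ 3 -> f = g.
Proof.
move=> e; have : (f + g) * (f ^+ 2 + f * g + g ^+ 2) = 0.
  have -> : (f + g) * (f ^+ 2 + f * g + g ^+ 2) = f ^+ 3 + g ^+ 3 by char2 f g.
  by rewrite e S_addrr.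
case/S_mulf_eq0 => [/S_addr_eq0//|].
have key (a b : nat) (f1 g1 : S) : (a <= b)%N -> f1 a = 1 ->
    (forall i, (i < a)%N -> f1 i = 0) -> (forall i, (i < b)%N -> g1 i = 0) ->
    f1 ^+ 2 + f1 * g1 + g1 ^+ 2 <> 0.
  move=> ab fa fl gl; have gl' i : (i < a)%N -> g1 i = 0 by move=> ia; apply: gl; lia.
  apply: (@S_neq0 _ (a + a)); rewrite !expr2.
  transitivity ((f1 * f1) (a + a)%N + (f1 * g1) (a + a)%N + (g1 * g1) (a + a)%N); first by [].
  by rewrite !coefM_lead // fa !mul1r F2_sqr -addrA F2_addrr addr0.
case: (pselect (f = 0)) => [->|/valuationP[a [fa fl]]].
  rewrite mul0r expr2 mul0r !add0r expr2 => /S_mulf_eq0[] -> //.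
case: (pselect (g = 0)) => [->|/valuationP[b [gb gl]]].
  rewrite mulr0 (expr2 0) mul0r !addr0 expr2 => /S_mulf_eq0[] -> //.
case: (leqP a b) => ab q; first by case: (key a b f g ab fa fl gl).
case: (key b a g f (ltnW ab) gb gl fl).
by rewrite -q; char2 f g.
Qed.

(** The parameter is t = s(x^3). Both claims follow from [D_cube]; the second compares cubes, hence
    the exponent [k * 3]. *)
Lemma V_D_cube p (P : S -> S) k : (forall f, V 3 (P f) = P (V 3 f)) -> (0 < p)%N ->
  (exists s : S, s = Fth * P s /\ V p Fth = Fth * s ^+ (k * 3)) ->
  exists t : S, D ^+ 3 * P t = t /\ V p D = D * t ^+ k.
Proof.
move=> VP p0 [s [es ep]]; exists (V 3 s); split.
  by rewrite -VP D_cube -VM // -es.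
apply: S_cube_inj.
have -> : V p D ^+ 3 = V p (V 3 Fth) by rewrite -D_cube VX.
have -> : V p (V 3 Fth) = V 3 (V p Fth) by rewrite VV // mulnC VV.
rewrite ep.
have -> : V 3 (Fth * s ^+ (k * 3)) = V 3 Fth * V 3 s ^+ (k * 3).
  exact: etrans (@VM 3 Fth (s ^+ (k * 3)) isT) (congr1 _ (@VX 3 s (k * 3) isT)).
by rewrite -[V 3 Fth]D_cube exprM -exprMn.
Qed.

Lemma D_mod7 : let E := V 7 D in
  D ^+ 8 + D ^+ 4 * E ^+ 4 + D * E + E ^+ 8 = 0.
Proof.
have [|//|t [et ->]] := @V_D_cube 7 P7 2 _ _ modular_Fth7.
  by move=> f; rewrite /P7 VX // !VD VX // V1.
cbv zeta; move: D et => d et.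
(* With E = D t^2 the left side becomes D^2 times the square of D^3 P(t) + t, which vanishes. *)
have -> : d ^+ 8 + d ^+ 4 * (d * t ^+ 2) ^+ 4 + d * (d * t ^+ 2) + (d * t ^+ 2) ^+ 8
  = d ^+ 2 * ((d ^+ 3 * (1 + t + t ^+ 2) ^+ 4) ^+ 2 + t ^+ 2) by char2 d t.
by rewrite -/(P7 t) et S_addrr mulr0.
Qed.

Lemma D_mod13 : let E := V 13 D in
  D ^+ 14 + D ^+ 12 * E ^+ 2 + D ^+ 2 * E ^+ 12 + D * E + E ^+ 14 = 0.
Proof.
have [|//|t [et ->]] := @V_D_cube 13 P13 4 _ _ modular_Fth13.
  by move=> f; rewrite /P13 VM // !VX // !VD VX // V1.
cbv zeta; move: D et => d et.
have -> : d ^+ 14 + d ^+ 12 * (d * t ^+ 4) ^+ 2 + d ^+ 2 * (d * t ^+ 4) ^+ 12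
   + d * (d * t ^+ 4) + (d * t ^+ 4) ^+ 14
  = d ^+ 2 * ((d ^+ 3 * ((1 + t) ^+ 6 * (1 + t + t ^+ 2) ^+ 4)) ^+ 4 + t ^+ 4) by char2 d t.
by rewrite -/(P13 t) et S_addrr mulr0.
Qed.

(* A relation is listed by the exponents (i, j) of its monomials [a ^ i b ^ j]. *)
Definition psum (L : seq (nat * nat)) (a b : S) : S := \sum_(x <- L) a ^+ x.1 * b ^+ x.2.

(** The relation is used in both orders of its variables: on the [V p] part it relates [a] to
    [V p a], while a factor [a ^+ i] enters [U p] as [V p a ^+ i], which calls for the exchanged
    relation. *)
Lemma T_rec p L N (a c : S) : (0 < p)%N ->
  psum ((0, N) :: L) a (V p a) = 0 -> psum ((0, N) :: L) (V p a) a = 0 ->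
  forall n, T p (c * a ^+ (n + N)) = \sum_(x <- L) a ^+ x.1 * T p (c * a ^+ (n + x.2)).
Proof.
move=> p0 e1 e2 n; apply: S_addr_eq0.
transitivity (\sum_(x <- (0, N) :: L) a ^+ x.1 * T p (c * a ^+ (n + x.2))).
  by rewrite big_cons /= expr0 mul1r.
under eq_bigr => x _ do rewrite TE mulrDr -UVM // VM // (@VX p a x.1) // (@VX p a (n + x.2)) //.
rewrite big_split /=.
have -> : \sum_(x <- (0, N) :: L) U p (V p a ^+ x.1 * (c * a ^+ (n + x.2)))
   = U p (c * a ^+ n * psum ((0, N) :: L) (V p a) a).
  rewrite -(big_morph (U p) (UD p) (erefl : U p 0 = 0)); congr (U p _).
  rewrite /psum mulr_sumr; apply: eq_bigr => x _; rewrite exprD; ring.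
have -> : \sum_(x <- (0, N) :: L) a ^+ x.1 * (V p c * V p a ^+ (n + x.2))
   = V p c * V p a ^+ n * psum ((0, N) :: L) a (V p a).
  rewrite /psum mulr_sumr; apply: eq_bigr => x _; rewrite exprD; ring.
rewrite e1 e2; move: (c * a ^+ n) (V p c * V p a ^+ n) => A B.
by rewrite !mulr0 addr0; apply: fps_ext.
Qed.

(** If p divides m^2 then m = pk and m^2 / p = p k^2; since p is prime to 6, the condition on m is
    that on k. *)
Lemma U_D p : prime p -> (4 < p)%N -> U p D = V p D.
Proof.
move=> pp p4; have p0 : (0 < p)%N by lia.
have p6 k : (gcdn (p * k) 6 == 1)%N = (gcdn k 6 == 1)%N.
  have c6 : coprime p 6.
    rewrite -[6%N]/(2 * 3)%N coprimeMr !(coprime_sym p) !prime_coprime //.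
    by rewrite !dvdn_prime2 //; lia.
  by rewrite -/(coprime (p * k) 6) -/(coprime k 6) coprimeMl c6.
have V1E (f : S) m : f m = V 1 f m by rewrite /= dvd1n divn1.
apply: fps_ext => n; rewrite D_theta.
set A := fun n => _; transitivity (V 1 (theta A) (p * n)%N); first by rewrite -V1E.
set B := (p * n).+1.
rewrite (@coefV_theta A 1 (p * n) (B * p)) //; last by rewrite /B; nia.
rewrite (@coefV_theta A p n B) //; last by rewrite /B; nia.
rewrite (bigID (fun k : 'I_(B * p) => (p %| k)%N)) /= [X in _ + X]big1 ?addr0; last first.
  move=> k npk; case: eqP => [e|]; last by rewrite andbF.
  have : (p %| k ^ 2)%N by rewrite -[(k ^ 2)%N]mul1n e dvdn_mulr.
  by rewrite Euclid_dvdX // (negbTE npk).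
have b (k : 'I_B) : (p * k < B * p)%N by rewrite mulnC ltn_pmul2r.
rewrite (reindex_onto (fun k : 'I_B => Ordinal (b k))
  (fun k : 'I_(B * p) => inord (k %/ p))) /=; last first.
  move=> k pk; apply: val_inj; rewrite /= inordK; first by rewrite mulnC divnK.
  by rewrite ltn_divLR.
rewrite (eq_bigl xpredT) => [|k].
  apply: eq_bigr => k _; rewrite /A p6 muln_gt0 p0 /= expnMn mul1n -mulnn -mulnA.
  by rewrite eqn_pmul2l.
by rewrite dvdn_mulr //=; apply/eqP; apply: val_inj; rewrite /= mulKn // inordK.
Qed.

Lemma D_sparse n : (1 < n < 25)%N -> D n = 0.
Proof.
move=> n1; rewrite /= big_pred0 // => k; apply/negbTE/negP => /and3P[k0 kc /eqP kn].
have k5 : (k < 5)%N by nia.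
by case: (nat_of_ord k) k0 kc kn k5 n1 => [|[|[|[|[|]]]]] //; lia.
Qed.

Lemma T_low p f : T p f 0%N = 0.
Proof. by rewrite /= muln0 dvdn0 div0n F2_addrr. Qed.

Lemma T1 p : (0 < p)%N -> T p 1 = 0.
Proof.
move=> p0; apply: fps_ext => n; rewrite TE V1 //; case: n => [|n].
  by rewrite /= muln0 F2_addrr.
by rewrite /= muln_eq0 (gtn_eqF p0) addr0.
Qed.

Lemma T_D p : prime p -> (4 < p)%N -> T p D = 0.
Proof. by move=> pp p4; rewrite TE U_D // S_addrr. Qed.

Lemma D_pow_lead k : (D ^+ k) k = 1.
Proof. by have := coefX_lead k D_low D1; rewrite muln1. Qed.

Lemma T_D_lead p : (1 < p)%N -> T p (D ^+ p) 1%N = 1.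
Proof.
move=> p1; rewrite /T [LHS]/= -[X in X + _]/((D ^+ p) (p * 1)%N) muln1 D_pow_lead.
by rewrite ifN ?addr0 // dvdn1; lia.
Qed.

(** * Initial values for the recursions *)

Section InitialValues.
Variables (d : S) (t : nat -> S).
Hypothesis d_low : forall i, (i < 1)%N -> d i = 0.
Hypothesis d1 : d 1%N = 1.
Hypothesis t0 : t 0%N = 0.
Hypothesis t1 : t 1%N = 0.
Hypothesis t_low : forall k, t k 0%N = 0.
Hypothesis t_double : forall k, t k.*2 = t k ^+ 2.

Let d_neq0 : d <> 0. Proof. exact: S_neq0 d1. Qed.

Let d_pow_low k i : (i < k)%N -> (d ^+ k) i = 0.
Proof. by move=> ik; apply: (coefX_low d_low); rewrite muln1. Qed.

Let d_pow_lead k : (d ^+ k) k = 1.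
Proof. by have := coefX_lead k d_low d1; rewrite muln1. Qed.

Let sqr_eq0 (f : S) : f ^+ 2 = 0 -> f = 0.
Proof. by rewrite expr2 => /S_mulf_eq0[]. Qed.

(** Comparing the recursion with doubling at indices 10 and 12 gives t_3^8 = d^6 t_3^2 + d^3 t_3; if
    t_3 had valuation v > 0, the last term alone would have a coefficient at x^(3+v). Index 14 gives
    t_7^2 = d t_7. *)
Lemma initial7 :
  (forall n, t (n + 8)%N = d ^+ 4 * t (n + 4)%N + d * t (n + 1)%N + d ^+ 8 * t n) ->
  t 7 1%N = 1 -> (forall k, (k < 7)%N -> t k = 0) /\ t 7 = d.
Proof.
move=> rec t71.
have t2 : t 2 = 0 by rewrite (t_double 1) t1 expr0n.
have t4 : t 4 = 0 by rewrite (t_double 2) t2 expr0n.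
have t8 : t 8 = 0 by rewrite (t_double 4) t4 expr0n.
have t6 : t 6 = t 3 ^+ 2 by rewrite (t_double 3).
have e10 : t 5 ^+ 2 = d ^+ 4 * t 3 ^+ 2 + d * t 3.
  by rewrite -(t_double 5) (rec 2) t2 mulr0 addr0 -(t_double 3).
have e12 : t 3 ^+ 4 = d * t 5.
  rewrite -[4%N]/(2 * 2)%N exprM -t6 -(t_double 6) (rec 4) t8 t4 !mulr0.
  by rewrite add0r addr0.
have t3 : t 3 = 0.
  case: (pselect (t 3 = 0)) => // /valuationP[v [tv tl]].
  have v0 : (0 < v)%N by case: v tv {tl} => //; rewrite t_low => /esym/eqP; rewrite oner_eq0.
  have : (t 3 ^+ 8) (3 + v)%N = (d ^+ 6 * t 3 ^+ 2) (3 + v)%N + (d ^+ 3 * t 3) (3 + v)%N.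
    have -> : t 3 ^+ 8 = d ^+ 6 * t 3 ^+ 2 + d ^+ 3 * t 3; last by [].
    rewrite -[8%N]/(4 * 2)%N exprM e12 exprMn e10; move: (t 3) => x; ring.
  rewrite (coefX_low tl); last by lia.
  rewrite (coefM_low (@d_pow_low 6) (coefX_low tl)); last by lia.
  by rewrite (coefM_lead (@d_pow_low 3) tl) d_pow_lead tv mul1r add0r
    => /esym/eqP; rewrite oner_eq0.
have t5 : t 5 = 0.
  by apply: (S_mulfI d_neq0); rewrite -e12 t3 mulr0 expr0n.
have t6' : t 6 = 0 by rewrite t6 t3 expr0n.
split; first by case=> [|[|[|[|[|[|[|]]]]]]].
have : t 7 * (t 7 + d) = 0.
  rewrite mulrDr -expr2 -(t_double 7) (rec 6) t6' (t_double 5) t5 expr0n !mulr0 add0r addr0.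
  by rewrite mulrC S_addrr.
by case/S_mulf_eq0 => [e|/S_addr_eq0//]; case: (S_neq0 t71 e).
Qed.

(** Even indices give t_3 = d^3 t_3^4, which forces t_3 = 0, and t_5^4 = d^3 t_5, which would also
    allow t_5 = d; the hypothesis on the coefficient of [t 5] excludes that. *)
Lemma initial13 :
  (forall n, t (n + 14)%N =
     d ^+ 2 * t (n + 12)%N + d ^+ 12 * t (n + 2)%N + d * t (n + 1)%N + d ^+ 14 * t n) ->
  t 5 1%N = 0 -> t 13 1%N = 1 -> (forall k, (k < 13)%N -> t k = 0) /\ t 13 = d.
Proof.
move: (d ^+ 14) (d ^+ 12) => a b rec t51 t131.
have z k : t k = 0 -> t k.*2 = 0 by move=> e; rewrite t_double e expr0n.
have t2 : t 2 = 0 := z 1%N t1.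
have t4 : t 4 = 0 := z 2 t2.
have t8 : t 8 = 0 := z 4 t4.
have t16 : t 16 = 0 := z 8 t8.
have e14 : t 14 = d ^+ 2 * t 3 ^+ 4.
  have -> : t 3 ^+ 4 = t 12 by rewrite -[4%N]/(2 * 2)%N exprM -(t_double 3) -(t_double 6).
  by have := rec 0%N; rewrite t2 t1 t0 !mulr0 !addr0.
have e16 : d * t 3 = d * (d ^+ 3 * t 3 ^+ 4).
  apply: S_addr_eq0; rewrite -[RHS]t16 (rec 2) t4 t2 !mulr0 !addr0 e14.
  move: (t 3) => x; ring.
have t3 : t 3 = 0.
  have e := S_mulfI d_neq0 e16.
  case: (pselect (t 3 = 0)) => // /valuationP[v [tv tl]].
  have := congr1 (fun f : S => f v) e.
  rewrite tv (coefM_low (@d_pow_low 3) (coefX_low tl)); last by lia.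
  by move/eqP; rewrite oner_eq0.
have t7 : t 7 = 0.
  by apply: sqr_eq0; rewrite -(t_double 7) e14 t3 expr0n mulr0.
have t6 := z 3 t3; have t12 := z 6 t6; have t24 := z 12 t12; have t14 := z 7 t7.
have e18 : t 9 ^+ 2 = d * t 5.
  by rewrite -(t_double 9) (rec 4) t16 t6 t4 !mulr0 !add0r addr0.
have e20 : t 5 ^+ 4 = d ^+ 3 * t 5.
  rewrite -[4%N]/(2 * 2)%N exprM -(t_double 5) -(t_double 10) (rec 6) t8 t7 t6 !mulr0 !addr0.
  rewrite (t_double 9) e18; move: (t 5) => x; ring.
have t5 : t 5 = 0.
  case: (pselect (t 5 = 0)) => // /valuationP[v [tv tl]].
  have c : (t 5 ^+ 4) (3 + v)%N = 1.
    by rewrite e20 (coefM_lead (@d_pow_low 3) tl) d_pow_lead tv mul1r.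
  have c' : (d ^+ 3 * t 5) (4 * v)%N = 1 by rewrite -e20 coefX_lead.
  have v1 : v = 1%N.
    case: (ltngtP v 1%N) => // h.
      move: c'; rewrite (coefM_low (@d_pow_low 3) tl); last by lia.
      by move/esym/eqP; rewrite oner_eq0.
    move: c; rewrite (coefX_low tl); last by lia.
    by move/esym/eqP; rewrite oner_eq0.
  by move: tv; rewrite v1 t51 => /esym/eqP; rewrite oner_eq0.
have t9 : t 9 = 0 by apply: sqr_eq0; rewrite e18 t5 mulr0.
have t10 := z 5 t5; have t20 := z 10 t10.
have t11 : t 11 = 0.
  apply: sqr_eq0; rewrite -(t_double 11) (rec 8) t20 t10 t9 t8 !mulr0 !addr0 //.
split; first by case=> [|[|[|[|[|[|[|[|[|[|[|[|[|]]]]]]]]]]]]].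
have : t 13 * (t 13 + d) = 0.
  rewrite mulrDr -expr2 -(t_double 13) (rec 12) t24 t14 t12 !mulr0 !add0r addr0.
  by rewrite mulrC S_addrr.
by case/S_mulf_eq0 => [e|/S_addr_eq0//]; case: (S_neq0 t131 e).
Qed.

End InitialValues.

Lemma T_D_double p k : odd p -> T p (D ^+ k.*2) = T p (D ^+ k) ^+ 2.
Proof. by move=> op; rewrite -muln2 exprM T_sqr. Qed.

Definition D7_terms := [:: (4, 4); (1, 1); (8, 0)]%N.
Definition D13_terms := [:: (2, 12); (12, 2); (1, 1); (14, 0)]%N.

Lemma psum_seq1 x (a b : S) : psum [:: x] a b = a ^+ x.1 * b ^+ x.2.
Proof. exact: big_seq1. Qed.

Lemma psum_cons x y L (a b : S) :
  psum [:: x, y & L] a b = a ^+ x.1 * b ^+ x.2 + psum (y :: L) a b.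
Proof. exact: big_cons. Qed.

Lemma psum_D7 : psum ((0, 8)%N :: D7_terms) D (V 7 D) = 0 /\
  psum ((0, 8)%N :: D7_terms) (V 7 D) D = 0.
Proof.
have := D_mod7; cbv zeta; move: D (V 7 D) => d e.
rewrite /D7_terms !psum_cons !psum_seq1 /= => h.
by split; rewrite -h; char2 d e.
Qed.

Lemma psum_D13 : psum ((0, 14)%N :: D13_terms) D (V 13 D) = 0 /\
  psum ((0, 14)%N :: D13_terms) (V 13 D) D = 0.
Proof.
have := D_mod13; cbv zeta; move: D (V 13 D) => d e.
rewrite /D13_terms !psum_cons !psum_seq1 /= => h.
by split; rewrite -h; char2 d e.
Qed.

Lemma T7_D_rec n : T 7 (D ^+ (n + 8)) = \sum_(x <- D7_terms) D ^+ x.1 * T 7 (D ^+ (n + x.2)).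
Proof.
have [e1 e2] := psum_D7; have := @T_rec 7 D7_terms 8 D 1 isT e1 e2 n.
by rewrite mul1r => ->; apply: eq_bigr => x _; rewrite mul1r.
Qed.

Lemma T13_D_rec n : T 13 (D ^+ (n + 14)) = \sum_(x <- D13_terms) D ^+ x.1 * T 13 (D ^+ (n + x.2)).
Proof.
have [e1 e2] := psum_D13; have := @T_rec 13 D13_terms 14 D 1 isT e1 e2 n.
by rewrite mul1r => ->; apply: eq_bigr => x _; rewrite mul1r.
Qed.

Lemma T7_D_initial : (forall k, (k < 7)%N -> T 7 (D ^+ k) = 0) /\ T 7 (D ^+ 7) = D.
Proof.
apply: (@initial7 D (fun k => T 7 (D ^+ k)) D_low D1).
- exact: T1.
- exact: T_D.
- by move=> k; exact: T_low.
- by move=> k; exact: T_D_double.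
- move=> n; rewrite T7_D_rec 2!big_cons big_seq1 addn0; exact: addrA.
exact: T_D_lead.
Qed.

(** D^5 = D(x) D(x^4) and D = x + O(x^25), so only 13 = 1 + 12 is left, and 12/4 = 3 is not an
    exponent of D. *)
Lemma D5_13 : (D ^+ 5) 13 = 0.
Proof.
rewrite exprS S_pow4 [LHS]big1 // => i _; case: (posnP i) => [->|i0].
  by rewrite D_low // mul0r.
case: (ltnP 1 i) => i1; first by rewrite D_sparse ?mul0r //; move: (ltn_ord i); lia.
have -> : (i : nat) = 1%N by lia.
by rewrite [X in _ * X]/= [X in _ * X]D_sparse // mulr0.
Qed.

Lemma T13_D_initial : (forall k, (k < 13)%N -> T 13 (D ^+ k) = 0) /\ T 13 (D ^+ 13) = D.
Proof.
apply: (@initial13 D (fun k => T 13 (D ^+ k)) D_low D1).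
- exact: T1.
- exact: T_D.
- by move=> k; exact: T_D_double.
- move=> n; rewrite T13_D_rec 3!big_cons big_seq1 addn0 addrA addrA; reflexivity.
- rewrite /T [LHS]/= -[X in X + _]/((D ^+ 5) (13 * 1)%N) muln1 D5_13; exact: addr0.
exact: T_D_lead.
Qed.

(** * Computing T_p on D^(6n+5) *)

(* The relations between [D ^ 6] and [V p (D ^ 6)], without the leading terms. *)
Definition y7_terms := [:: (1, 1); (2, 2); (8, 0)]%N.
Definition y13_terms := [:: (2, 12); (4, 10); (6, 8); (8, 6); (10, 4); (12, 2); (14, 0);
  (1, 1); (9, 1); (1, 9)]%N.

Lemma psum_y7 : psum ((0, 8)%N :: y7_terms) (D ^+ 6) (V 7 (D ^+ 6)) = 0 /\
  psum ((0, 8)%N :: y7_terms) (V 7 (D ^+ 6)) (D ^+ 6) = 0.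
Proof.
rewrite (@VX 7 D 6 isT); have := D_mod7; cbv zeta; move: D (V 7 D) => d e.
rewrite /y7_terms !psum_cons !psum_seq1 /= => h.
by split; char2_dvd0 d e h.
Qed.

Lemma psum_y13 : psum ((0, 14)%N :: y13_terms) (D ^+ 6) (V 13 (D ^+ 6)) = 0 /\
  psum ((0, 14)%N :: y13_terms) (V 13 (D ^+ 6)) (D ^+ 6) = 0.
Proof.
rewrite (@VX 13 D 6 isT); have := D_mod13; cbv zeta; move: D (V 13 D) => d e.
rewrite /y13_terms !psum_cons !psum_seq1 /= => h.
by split; char2_dvd0 d e h.
Qed.

Definition shift1 k (l : seq bool) : seq bool := nseq k false ++ l.

Lemma ev1_shift y k l : ev1 y (shift1 k l) = y ^+ k * ev1 y l.
Proof.
elim: k => [|k IH]; first by rewrite mul1r.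
by rewrite exprS -mulrA -IH /= add0r.
Qed.

Lemma nth_shift k l m : nth false (shift1 k l) m = (k <= m)%N && nth false l (m - k).
Proof. by rewrite nth_cat size_nseq nth_nseq; case: (ltnP m k) => //= ->. Qed.

Lemma nth_add1 a b m : nth false (add1 a b) m = nth false a m (+) nth false b m.
Proof.
elim: a b m => [|x a IH] [|z b] [|m] //=; rewrite ?nth_nil ?addbF ?addFb //.
Qed.

(* Sequences of polynomials in [a] with [f (n + N) = sum_(x <- L) a ^ x.1 f (n + x.2)],
   computed from their first [N] terms. *)
Section Rows.
Variables (L : seq (nat * nat)) (N : nat) (init : seq (seq bool)).
Hypothesis L_lt : all (fun x => x.2 < N)%N L.
Hypothesis N_gt0 : (0 < N)%N.
Hypothesis size_init : size init = N.

Definition recseq_next (w : seq (seq bool)) : seq bool :=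
  foldr (fun x => add1 (shift1 x.1 (nth [::] w x.2))) [::] L.
Definition window n := iter n (fun w => rcons (behead w) (recseq_next w)) init.
Definition recseq n := head [::] (window n).

Lemma size_window n : size (window n) = N.
Proof. by elim: n => //= n IH; rewrite size_rcons size_behead IH prednK. Qed.

Lemma nth_window n i : (i < N)%N -> nth [::] (window n) i = recseq (n + i)%N.
Proof.
elim: i n => [|i IH] n iN; first by rewrite addn0 nth0.
rewrite addnS -addSn -IH //=; last by lia.
by rewrite nth_rcons size_behead size_window nth_behead ifT //; lia.
Qed.

Lemma recseq_init n : (n < N)%N -> recseq n = nth [::] init n.
Proof. by move=> nN; rewrite -[init]/(window 0) nth_window. Qed.

Lemma recseq_rec n : recseq (n + N) = foldr (fun x => add1 (shift1 x.1 (recseq (n + x.2)))) [::] L.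
Proof.
have -> : recseq (n + N) = recseq_next (window n).
  have -> : recseq (n + N) = recseq (n.+1 + N.-1)%N by congr recseq; lia.
  rewrite -nth_window ?prednK //= nth_rcons size_behead size_window ltnn eqxx //.
rewrite /recseq_next; elim: L L_lt => //= x l IH /andP[x2 /IH ->].
by rewrite nth_window.
Qed.

Lemma recseq_ev (f : nat -> S) (a c : S) :
  (forall n, f (n + N)%N = \sum_(x <- L) a ^+ x.1 * f (n + x.2)%N) ->
  (forall n, (n < N)%N -> f n = c * ev1 a (nth [::] init n)) ->
  forall n, f n = c * ev1 a (recseq n).
Proof.
move=> frec finit; elim/ltn_ind => n IH; case: (ltnP n N) => nN.
  by rewrite recseq_init // finit.
rewrite -(subnK nN) frec recseq_rec.
have : all (fun x => n - N + x.2 < n)%N L.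
  by apply: sub_all L_lt => x; lia.
elim: L => [_|x l IHl /= /andP[xn /IHl e]]; first by rewrite big_nil /= mulr0.
by rewrite big_cons /= ev1_add ev1_shift e mulrDr mulrCA IH.
Qed.

End Rows.

Definition D7_init : seq (seq bool) := rcons (nseq 7 [::]) [:: false; true].
Definition D13_init : seq (seq bool) := rcons (nseq 13 [::]) [:: false; true].

Lemma T7_D_row n : T 7 (D ^+ n) = 1 * ev1 D (recseq D7_terms D7_init n).
Proof.
move: n; apply: (@recseq_ev D7_terms 8 D7_init isT isT erefl
  (fun n => T 7 (D ^+ n)) D 1) => [|n n8].
  exact: T7_D_rec.
have [z e] := T7_D_initial; rewrite mul1r nth_rcons size_nseq nth_nseq.
case: (ltngtP n 7) n8 => [n7 _|n7|-> _]; [by rewrite z|lia|].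
by rewrite e /= add0r mulr0 addr0 mulr1.
Qed.

Lemma T13_D_row n : T 13 (D ^+ n) = 1 * ev1 D (recseq D13_terms D13_init n).
Proof.
move: n; apply: (@recseq_ev D13_terms 14 D13_init isT isT erefl
  (fun n => T 13 (D ^+ n)) D 1) => [|n n8].
  exact: T13_D_rec.
have [z e] := T13_D_initial; rewrite mul1r nth_rcons size_nseq nth_nseq.
case: (ltngtP n 13) n8 => [n7 _|n7|-> _]; [by rewrite z|lia|].
by rewrite e /= add0r mulr0 addr0 mulr1.
Qed.

(* [l] read as [D ^ 5] times a polynomial in [D ^ 6]. *)
Definition sections (l : seq bool) : seq bool :=
  [seq nth false l (6 * i + 5)%N | i <- iota 0 (size l)].
Definition spread (l : seq bool) : seq bool :=
  shift1 5 (flatten [seq b :: nseq 5 false | b <- l]).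

Lemma ev1_spread y l : ev1 y (spread l) = y ^+ 5 * ev1 (y ^+ 6) l.
Proof.
rewrite ev1_shift; congr (_ * _); elim: l => // b l IH.
rewrite [LHS]/(b%:R + y * ev1 y (shift1 5 (flatten [seq b :: nseq 5 false | b <- l]))).
by rewrite ev1_shift IH mulrA -exprS.
Qed.

Lemma ev1_eq y a b : zero1 (add1 a b) -> ev1 y a = ev1 y b.
Proof. by move=> z; apply: S_addr_eq0; rewrite -ev1_add ev1_zero. Qed.

Definition y_init N (D_row : nat -> seq bool) : seq (seq bool) :=
  [seq sections (D_row (6 * n + 5)%N) | n <- iota 0 N].

(** [sections] forgets the exponents other than 5 mod 6; the check shows that the rows used have
    none. *)
Lemma y_initP p N D_row (init := y_init N D_row) :
  (forall n, T p (D ^+ n) = 1 * ev1 D (D_row n)) ->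
  all (fun n => zero1 (add1 (D_row (6 * n + 5)%N) (spread (nth [::] init n)))) (iota 0 N) ->
  forall n, (n < N)%N -> T p (D ^+ 5 * (D ^+ 6) ^+ n) = D ^+ 5 * ev1 (D ^+ 6) (nth [::] init n).
Proof.
move=> TD /allP chk n nN; rewrite -exprM -exprD addnC TD mul1r -ev1_spread.
by apply: ev1_eq; apply: chk; rewrite mem_iota.
Qed.

Definition y7_init := Eval vm_compute in y_init 8 (recseq D7_terms D7_init).
Definition y13_init := Eval vm_compute in y_init 14 (recseq D13_terms D13_init).
(** The coefficient of D^(6m+5) in T_7 (D^(6n+5)). *)
Definition G7 n m := nth false (recseq y7_terms y7_init n) m.
Definition G13 n m := nth false (recseq y13_terms y13_init n) m.

Lemma T7_y n : T 7 (D ^+ 5 * (D ^+ 6) ^+ n) = D ^+ 5 * ev1 (D ^+ 6) (recseq y7_terms y7_init n).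
Proof.
move: n; apply: (@recseq_ev y7_terms 8 y7_init isT isT erefl
  (fun n => T 7 (D ^+ 5 * (D ^+ 6) ^+ n)) (D ^+ 6) (D ^+ 5)).
  have [e1 e2] := psum_y7; exact: (@T_rec 7 y7_terms 8 (D ^+ 6) (D ^+ 5) isT e1 e2).
apply: (@y_initP 7 8 (recseq D7_terms D7_init) T7_D_row).
by vm_compute.
Qed.

Lemma T13_y n : T 13 (D ^+ 5 * (D ^+ 6) ^+ n) = D ^+ 5 * ev1 (D ^+ 6) (recseq y13_terms y13_init n).
Proof.
move: n; apply: (@recseq_ev y13_terms 14 y13_init isT isT erefl
  (fun n => T 13 (D ^+ 5 * (D ^+ 6) ^+ n)) (D ^+ 6) (D ^+ 5)).
  have [e1 e2] := psum_y13; exact: (@T_rec 13 y13_terms 14 (D ^+ 6) (D ^+ 5) isT e1 e2).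
apply: (@y_initP 13 14 (recseq D13_terms D13_init) T13_D_row).
by vm_compute.
Qed.

(** * Rational series mod 2 and their automata *)

Local Close Scope ring_scope.

Definition shifted (G : nat -> nat -> bool) n m (x : nat * nat) :=
  [&& x.1 <= n, x.2 <= m & G (n - x.1) (m - x.2)].
(** Coefficients of the product of the series [G] with the polynomial whose exponent pairs are
    listed in [L]. *)
Definition conv (L : seq (nat * nat)) (G : nat -> nat -> bool) n m : bool :=
  \big[addb/false]_(x <- L) shifted G n m x.
Definition ent (s : seq (seq bool)) n m := nth false (nth [::] s n) m.

(** Squaring in characteristic 2: the cross terms occur twice and cancel. *)
Lemma conv_conv L G n m :
  conv L (conv L G) n m = \big[addb/false]_(x <- L) shifted G n m (x.1 + x.1, x.2 + x.2).
Proof.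
pose g (x y : nat * nat) := shifted G n m (x.1 + y.1, x.2 + y.2).
have -> : conv L (conv L G) n m =
    \big[addb/false]_(x <- L) \big[addb/false]_(y <- L) g x y.
  apply: eq_bigr => x _; rewrite /shifted /conv.
  case: (leqP x.1 n) => xn; last first.
    by rewrite [RHS]big1 // => y _; rewrite /g /shifted /= leqNgt (ltn_addr _ xn).
  case: (leqP x.2 m) => xm; last first.
    by rewrite [RHS]big1 // => y _; rewrite /g /shifted /= andbCA leqNgt (ltn_addr _ xm).
  apply: eq_bigr => y _; rewrite /g /shifted /= !leq_subRL // !subnDA //.
elim: L => [|a L IH]; first by rewrite !big_nil.
rewrite !big_cons; under [in X in _ (+) X]eq_bigr do rewrite big_cons.
rewrite big_split /= IH /g.
have -> : \big[addb/false]_(x <- L) shifted G n m (x.1 + a.1, x.2 + a.2) =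
   \big[addb/false]_(x <- L) shifted G n m (a.1 + x.1, a.2 + x.2).
  by apply: eq_bigr => x _; rewrite !(addnC x.1) !(addnC x.2).
by rewrite -addbA addKb.
Qed.

Fixpoint evens (A : Type) (l : seq A) : seq A :=
  match l with
  | x :: l' => x :: (if l' is _ :: l'' then evens l'' else [::])
  | [::] => [::]
  end.
Definition sel (A : Type) (e : bool) (l : seq A) := evens (if e then behead l else l).

Lemma nth_sel (A : Type) (x0 : A) e l i : nth x0 (sel e l) i = nth x0 l (e + i.*2).
Proof.
rewrite /sel; have ev (l' : seq A) j : nth x0 (evens l') j = nth x0 l' j.*2.
  by elim: j l' => [|j IH] [|x [|y l']] //=; rewrite ?doubleS /= ?nth_nil ?IH.
by rewrite ev; case: e => //; rewrite nth_behead.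
Qed.

Definition sect e f (s : seq (seq bool)) := [seq sel f r | r <- sel e s].

Lemma ent_sect e f s n m : ent (sect e f s) n m = ent s (e + n.*2) (f + m.*2).
Proof.
rewrite /ent -(nth_sel [::] e s n) -(nth_sel false).
case: (ltnP n (size (sel e s))) => ns; first by rewrite (nth_map [::]).
by rewrite !(nth_default [::]) ?size_map // nth_sel !nth_nil.
Qed.

Lemma ent_add2 s s' n m : ent (add2 s s') n m = ent s n m (+) ent s' n m.
Proof.
rewrite /ent; elim: s s' n => [|r s IH] [|r' s'] [|n] //=;
  rewrite ?nth_nil ?addbF ?addFb ?nth_add1 //.
Qed.

Definition times (L : seq (nat * nat)) (s : seq (seq bool)) :=
  foldr (fun x => add2 (nseq x.1 [::] ++ map (shift1 x.2) s)) [::] L.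

Lemma ent_times L s n m : ent (times L s) n m = conv L (ent s) n m.
Proof.
rewrite /conv; elim: L => [|x L IH]; first by rewrite big_nil /ent !nth_nil.
rewrite big_cons /= ent_add2 IH; congr addb; rewrite /ent /shifted nth_cat size_nseq nth_nseq.
case: (ltnP n x.1) => xn /=; first by rewrite nth_nil.
case: (ltnP (n - x.1) (size s)) => ns.
  by rewrite (nth_map [::]) // nth_shift.
by rewrite !(nth_default [::]) ?size_map // !nth_nil andbF.
Qed.

(* The series with coefficients [G] is the quotient of [s] by the denominator [L]. *)
Definition rep L s G := forall n m, conv L G n m = ent s n m.
Definition section_of (G : nat -> nat -> bool) (e f : bool) n m := G (e + n.*2) (f + m.*2).

(* [s / L = s L / L^2], and [L^2] is a polynomial in the squares of the variables. *)
Lemma rep_section L s G e f : rep L s G -> rep L (sect e f (times L s)) (section_of G e f).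
Proof.
move=> r n m; rewrite ent_sect ent_times.
have -> : conv L (ent s) (e + n.*2) (f + m.*2) = conv L (conv L G) (e + n.*2) (f + m.*2).
  by apply: eq_bigr => x _; rewrite /shifted r.
rewrite conv_conv; apply: eq_bigr => x _; rewrite /shifted /section_of /=.
have d (b : bool) k l : (k + k <= b + l.*2) = (k <= l) by case: b; lia.
rewrite !d; case: (leqP x.1 n) => // xn; case: (leqP x.2 m) => // xm /=.
by congr G; lia.
Qed.

Lemma ent_zero (s : seq (seq bool)) n m : zero2 s -> ent s n m = false.
Proof.
move=> z; rewrite /ent; case: (ltnP n (size s)) => sn; last by rewrite (nth_default _ sn) nth_nil.
move/allP: z => /(_ _ (mem_nth [::] sn)) /allP z.
case: (ltnP m (size (nth [::] s n))) => ms; last by rewrite nth_default.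
exact/negbTE/z/mem_nth.
Qed.

Lemma eq_rep L s s' G : zero2 (add2 s s') -> rep L s G -> rep L s' G.
Proof.
move=> z r n m; rewrite r; have := ent_zero n m z.
by rewrite ent_add2; case: (ent s n m); case: (ent s' n m).
Qed.

(** [k] is fuel. Halving [n] shifts its digits by one place and so exchanges the even- and
    odd-indexed ones. *)
Fixpoint code_rec k n : nat * nat :=
  if k is k'.+1 then let c := code_rec k' n./2 in (odd n + c.2.*2, c.1) else (0, 0).
Definition code n := code_rec n n.

Lemma code_recE k l n : n <= k -> n <= l -> code_rec k n = code_rec l n.
Proof.
have rec0 k' : code_rec k' 0 = (0, 0) by elim: k' => //= k' ->.
elim: k l n => [|k IH] [|l] n nk nl.
- by [].
- by have -> : n = 0 by lia; rewrite !rec0.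
- by have -> : n = 0 by lia; rewrite !rec0.
by rewrite /= (IH l) //; lia.
Qed.

Lemma code_double (e : bool) n : code (e + n.*2) = (e + (code n).2.*2, (code n).1).
Proof.
rewrite {1}/code (@code_recE _ (e + n.*2).+1) //= (_ : (e + n.*2)./2 = n); last by lia.
by rewrite (@code_recE _ n) //; [case: e; rewrite ?oddD odd_double | lia].
Qed.

Lemma half_decomp n : exists (e : bool) n', n = e + n'.*2.
Proof. by exists (odd n), n./2; rewrite odd_double_half. Qed.

Lemma code_inj : injective code.
Proof.
move=> n m; have [k] := ubnP (n + m); elim: k n m => // k IH n m.
have [e [n' ->]] := half_decomp n; have [f [m' ->]] := half_decomp m.
rewrite !code_double => nm [h1 h2].
have [ef c2] : e = f /\ (code n').2 = (code m').2 by case: e f {nm} h1 => [] []; lia.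
rewrite ef; congr (_ + _.*2); case: (posnP (n' + m')) => nm0; first by lia.
apply: IH; first by lia.
by rewrite [LHS]surjective_pairing h2 c2 -surjective_pairing.
Qed.

Lemma code_surj a b : exists n, code n = (a, b).
Proof.
have [k] := ubnP (2 * a + 3 * b); elim: k a b => // k IH a b ab.
case: (posnP (a + b)) => ab0.
  by exists 0; rewrite /code /=; congr pair; lia.
have [n en] := IH b a./2 ltac:(lia).
by exists (odd a + n.*2); rewrite code_double en /= odd_double_half.
Qed.

Definition wt al be n := al * (code n).1 + be * (code n).2.

(** Dropping the last digit takes the weights (1, 1) to (1, 2), and these to twice (1, 1): this pair
    of weights is closed under reading digits. *)
Lemma wt_double al be (e : bool) n : wt al be (e + n.*2) = al * e + wt be al.*2 n.
Proof. by rewrite /wt code_double /=; lia. Qed.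

Lemma wt_scale al be n : wt al.*2 be.*2 n = (wt al be n).*2.
Proof. by rewrite /wt; lia. Qed.

(* A state of the automaton: a numerator [st] over the fixed denominator, the
   indices [tr] of its four sections, and claims about the coefficients [G n m]
   of the quotient: [G n m] implies [wt 1 1 m + b1 <= wt 1 1 n] and
   [wt 1 2 m + b2 <= wt 1 2 n], and, if [l0] (resp. [l1], [l2]), [G n m] holds
   when [code n - code m] is ([0], [0]) (resp. ([0], [1]), ([1], [0])). *)
Record node := Node { st : seq (seq bool); tr : seq nat; b1 : nat; b2 : nat;
  l0 : bool; l1 : bool; l2 : bool }.

Definition node0 := Node [::] [::] 0 0 false false false.
Definition succ_node ns (x : node) (e f : bool) := nth node0 ns (nth 0 (tr x) (e.*2 + f)).

(** [e] and [f] are the last digits of [n] and [m]. Halving exchanges the weights, hence [b1] is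
    compared with [b2] of the successor, and [b2] with twice its [b1]; a zero numerator makes the
    claims vacuous. *)
Definition bound_ok ns x (e f : bool) := let y := succ_node ns x e f in
  zero2 (st y) || ((b1 x + f <= e + b2 y) && (b2 x + f <= e + (b1 y).*2)).

(** For equal last digits a code difference (0, 1) becomes (1, 0) after halving. A difference (1, 0)
    becomes (0, 0) if the digits are 1 and 0, and (0, 1) if they are 0 and 1, by a carry. *)
Definition node_ok L ns x := let t := times L (st x) in
  [&& all (fun e => all (fun f => zero2 (add2 (sect e f t) (st (succ_node ns x e f))) &&
         bound_ok ns x e f) [:: false; true]) [:: false; true],
      ent (st x) 0 0 ==> (b1 x == 0) && (b2 x == 0),
      l0 x ==> [&& ent (st x) 0 0, l0 (succ_node ns x false false) & l0 (succ_node ns x true true)],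
      l1 x ==> l2 (succ_node ns x false false) && l2 (succ_node ns x true true) &
      l2 x ==> l0 (succ_node ns x true false) && l1 (succ_node ns x false true)].

Section Automaton.
Variables (N : nat) (terms : seq (nat * nat)).
Hypothesis terms_lt : all (fun x => x.2 < N) terms.

(* For [Phi(t, z) = z^N + sum t^i z^j], the exponents of [s^N Phi(t, 1/s)]. *)
Definition denominator := (0, 0) :: [seq (N - x.2, x.1) | x <- terms].
Let L := denominator.

Lemma conv_den G n m : conv L G n m =
  G n m (+) \big[addb/false]_(x <- terms) shifted G n m (N - x.2, x.1).
Proof. by rewrite /conv big_cons big_map /shifted /= !subn0. Qed.

(** Each further term of the denominator has a positive exponent in the first variable, so the
    coefficients with first index [n] are determined by those with smaller first index. *)
Lemma rep_zero s G n m : zero2 s -> rep L s G -> G n m = false.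
Proof.
move=> z r; elim/ltn_ind: n m => n IH m.
have := r n m; rewrite ent_zero // conv_den big_seq big1 ?addbF // => x xt.
rewrite /shifted /=; case: (leqP (N - x.2) n) => //= xn; case: (x.1 <= m) => //=.
by apply: IH; have /= := allP terms_lt _ xt; lia.
Qed.

Lemma rep00 s G : rep L s G -> G 0 0 = ent s 0 0.
Proof.
move=> r; rewrite -r conv_den big_seq big1 ?addbF // => x xt.
by rewrite /shifted /= leqn0 subn_eq0 leqNgt (allP terms_lt _ xt).
Qed.

Variables (ns : seq node) (x : node).
Hypothesis x_ok : node_ok L ns x.

Lemma succ_node_ok e f :
  zero2 (add2 (sect e f (times L (st x))) (st (succ_node ns x e f))) /\ bound_ok ns x e f.
Proof.
case/and5P: x_ok => /allP/(_ e) h _ _ _ _.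
have /allP/(_ f) : all (fun f =>
   zero2 (add2 (sect e f (times L (st x))) (st (succ_node ns x e f))) &&
   bound_ok ns x e f) [:: false; true] by apply: h; case: (e).
by case: f => /(_ isT)/andP[].
Qed.

Lemma rep_succ G e f : rep L (st x) G -> rep L (st (succ_node ns x e f)) (section_of G e f).
Proof. by move/(rep_section e f); apply: eq_rep; have [] := succ_node_ok e f. Qed.

End Automaton.

Section Claims.
Variables (N : nat) (terms : seq (nat * nat)) (ns : seq node).
Hypothesis terms_lt : all (fun x => x.2 < N) terms.
Let L := denominator N terms.
Hypothesis ns_ok : all (node_ok L ns) ns.

(** An index out of range yields [node0], which is harmless: its numerator is zero and it claims no
    nonzero coefficient. *)
Lemma succ_node_okP x e f : succ_node ns x e f = node0 \/ node_ok L ns (succ_node ns x e f).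
Proof.
rewrite /succ_node; case: (ltnP (nth 0 (tr x) (e.*2 + f)) (size ns)) => h;
  last by left; rewrite nth_default.
by right; move/(all_nthP node0): ns_ok; apply.
Qed.

Lemma automaton_bound x G n m : node_ok L ns x -> rep L (st x) G -> G n m ->
  wt 1 1 m + b1 x <= wt 1 1 n /\ wt 1 2 m + b2 x <= wt 1 2 n.
Proof.
have [k] := ubnP (n + m); elim: k n m x G => // k IH n m x G nk xok r.
have [nm0|nm0] := posnP (n + m).
  have [-> ->] : n = 0 /\ m = 0 by lia.
  rewrite (rep00 terms_lt r) => e; case/and5P: xok => _ /implyP/(_ e)/andP[/eqP-> /eqP->] _ _ _.
  by rewrite !addn0.
move: nk nm0; have [e [n' ->]] := half_decomp n; have [f [m' ->]] := half_decomp m => nk nm0 g.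
have r' := rep_succ xok e f r.
have [_ /orP[z|bnd]] := succ_node_ok xok e f.
  by move: (@rep_zero N terms terms_lt _ _ n' m' z r'); rewrite /section_of g.
case: (succ_node_okP x e f) => [z|yok].
  by rewrite z in r'; move: (@rep_zero N terms terms_lt [::] _ n' m' isT r'); rewrite /section_of g.
have [] := IH n' m' _ _ _ yok r' g; first by lia.
have d1 (d : bool) i : wt 1 1 (d + i.*2) = d + wt 1 2 i by rewrite wt_double mul1n.
have d2 (d : bool) i : wt 1 2 (d + i.*2) = d + (wt 1 1 i).*2 by rewrite wt_double mul1n -wt_scale.
by rewrite !d1 !d2; case/andP: bnd; lia.
Qed.

Lemma automaton_diag x G n : node_ok L ns x -> rep L (st x) G -> l0 x -> G n n.
Proof.
have [k] := ubnP n; elim: k n x G => // k IH n x G nk xok r lx.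
have := xok; case/and5P => _ _ /implyP/(_ lx)/and3P[e00 lf lt] _ _.
have [->|n0] := posnP n; first by rewrite (rep00 terms_lt r).
move: nk n0; have [e [n' ->]] := half_decomp n => nk n0.
have r' := rep_succ xok e e r.
have ly : l0 (succ_node ns x e e) by case: (e).
case: (succ_node_okP x e e) => [z|yok]; first by rewrite z in ly.
by apply: (IH n' _ _ _ yok r' ly); clear -nk n0; lia.
Qed.

(** The two claims feed each other under halving, hence the joint induction; once the remaining
    indices agree, [automaton_diag] applies. *)
Lemma automaton_step x G n m a b : node_ok L ns x -> rep L (st x) G ->
  (l1 x -> code n = (a, b.+1) -> code m = (a, b) -> G n m) /\
  (l2 x -> code n = (a.+1, b) -> code m = (a, b) -> G n m).
Proof.
have [k] := ubnP n; elim: k n m a b x G => // k IH n m a b x G nk xok r.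
have := xok; case/and5P => _ _ _ /implyP l1P /implyP l2P.
move: nk; have [e [n' ->]] := half_decomp n; have [f [m' ->]] := half_decomp m => nk.
have r' e f := rep_succ xok e f r.
rewrite !code_double; split=> [/l1P/andP[lf lt]|/l2P/andP[l10 l01]] [h1 h2] [h3 h4].
  have [ef nm] : e = f /\ (code n').2 = (code m').2.
    by clear -h1 h3; case: e f h1 h3 => [] []; lia.
  subst f; have ly : l2 (succ_node ns x e e) by case: (e).
  case: (succ_node_okP x e e) => [z|yok]; first by rewrite z in ly.
  have [] := IH n' m' b (code m').2 _ _ _ yok (r' e e); last first.
    move=> _ /(_ ly); apply; first by rewrite [code n']surjective_pairing h2 nm.
    by rewrite [code m']surjective_pairing h4.
  case: (posnP n') => [n0|n0]; first by rewrite n0 in h2.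
  by clear -nk n0; lia.
have [[ee [ff nm]]|[ee [ff nm]]] : (e = true /\ f = false /\ (code n').2 = (code m').2) \/
   (e = false /\ f = true /\ (code n').2 = (code m').2.+1).
  by clear -h1 h3; case: e f h1 h3 => [] []; lia.
- subst e f; case: (succ_node_okP x true false) => [z|yok]; first by rewrite z in l10.
  have -> : m' = n'.
    by apply: code_inj; rewrite [LHS]surjective_pairing [RHS]surjective_pairing nm h4 h2.
  exact: automaton_diag yok (r' true false) l10.
- subst e f; case: (succ_node_okP x false true) => [z|yok]; first by rewrite z in l01.
  have [] := IH n' m' b (code m').2 _ _ _ yok (r' false true); last first.
    move=> /(_ l01) h _; apply: h; first by rewrite [code n']surjective_pairing h2 nm.
    by rewrite [code m']surjective_pairing h4.
  case: (posnP n') => [n0|n0]; first by rewrite n0 in nm.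
  by clear -nk n0; lia.
Qed.

End Claims.

Section RowSeries.
Variables (L : seq (nat * nat)) (N : nat) (init : seq (seq bool)).
Hypothesis L_lt : all (fun x => x.2 < N) L.
Hypothesis N_gt0 : 0 < N.
Hypothesis size_init : size init = N.

(** By the recursion, the generating function times the denominator has no terms of degree [N] or
    more in the first variable; the lower terms only see the initial rows. *)
Lemma rep_recseq : rep (denominator N L) (take N (times (denominator N L) init))
  (fun n m => nth false (recseq L init n) m).
Proof.
move=> n m; case: (ltnP n N) => nN.
  have -> : ent (take N (times (denominator N L) init)) n m = conv (denominator N L) (ent init) n m.
    by rewrite -ent_times /ent nth_take.
  apply: eq_bigr => x _; rewrite /shifted; case: (x.1 <= n) => //=; case: (x.2 <= m) => //=.
  by rewrite (recseq_init L_lt N_gt0 size_init) // (leq_ltn_trans (leq_subr _ _)).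
rewrite /ent (nth_default [::]) ?nth_nil; last first.
  by rewrite (leq_trans _ nN) // size_take_min geq_minl.
rewrite conv_den -(subnK nN) (recseq_rec L_lt N_gt0 size_init).
rewrite (_ : nth false _ m = \big[addb/false]_(x <- L)
    ((x.1 <= m) && nth false (recseq L init (n - N + x.2)) (m - x.1))).
  rewrite -big_split big_seq big1 //= => x xL; rewrite /shifted /=.
  have xN := allP L_lt x xL.
  have -> : (N - x.2 <= n - N + N) by clear; lia.
  have -> : n - N + N - (N - x.2) = n - N + x.2 by clear -xN; lia.
  exact: addbb.
have foldr_nth (f : nat -> seq bool) l :
    nth false (foldr (fun x => add1 (shift1 x.1 (f x.2))) [::] l) m
    = \big[addb/false]_(x <- l) ((x.1 <= m) && nth false (f x.2) (m - x.1)).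
  elim: l => [|x l IH]; first by rewrite big_nil nth_nil.
  by rewrite big_cons /= nth_add1 IH nth_shift.
exact: (foldr_nth (fun j => recseq L init (n - N + j))).
Qed.

End RowSeries.

(* The search below is unverified: its result is certified by [node_ok]. The
   bounds are lowered from [20], which stands for infinity. *)
Definition eq_state (s t : seq (seq bool)) := zero2 (add2 s t).

Definition sections_of L s := let t := times L s in
  [:: sect false false t; sect false true t; sect true false t; sect true true t].

Fixpoint explore L k (todo seen : seq (seq (seq bool))) :=
  if k is k'.+1 then
    if todo is s :: todo' then
      let p := foldl (fun p x => if has (eq_state x) p.2 then p else (rcons p.1 x, rcons p.2 x))
        (todo', seen) (sections_of L s) in
      explore L k' p.1 p.2
    else seen
  else seen.

Definition refine ns x :=
  let digits := [:: (false, false); (false, true); (true, false); (true, true)] in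
  let targets := filter (fun y => ~~ zero2 (st y.2))
    (map (fun ef : bool * bool => (ef, succ_node ns x ef.1 ef.2)) digits) in
  Node (st x) (tr x)
    (foldr (fun (y : bool * bool * node) b => minn (y.1.1 + b2 y.2 - y.1.2) b) (b1 x) targets)
    (foldr (fun (y : bool * bool * node) b => minn (y.1.1 + (b1 y.2).*2 - y.1.2) b) (b2 x) targets)
    [&& l0 x, l0 (succ_node ns x false false) & l0 (succ_node ns x true true)]
    [&& l1 x, l2 (succ_node ns x false false) & l2 (succ_node ns x true true)]
    [&& l2 x, l0 (succ_node ns x true false) & l1 (succ_node ns x false true)].

Definition automaton L s k r :=
  let states := explore L k [:: s] [:: s] in
  iter r (fun ns => map (refine ns) ns)
    [seq let b := if ent t 0 0 then 0 else 20 in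
         Node t [seq find (eq_state x) states | x <- sections_of L t] b b (ent t 0 0) true true
       | t <- states].

Definition nodes7 := Eval vm_compute in
  automaton (denominator 8 y7_terms) (take 8 (times (denominator 8 y7_terms) y7_init)) 300 20.
Definition nodes13 := Eval vm_compute in
  automaton (denominator 14 y13_terms) (take 14 (times (denominator 14 y13_terms) y13_init)) 300 20.

Lemma nodes7_ok : all (node_ok (denominator 8 y7_terms) nodes7) nodes7.
Proof. by vm_compute. Qed.

Lemma nodes13_ok : all (node_ok (denominator 14 y13_terms) nodes13) nodes13.
Proof. by vm_compute. Qed.

Definition x7 := nth node0 nodes7 0.
Definition x13 := nth node0 nodes13 0.

Lemma x7_ok : node_ok (denominator 8 y7_terms) nodes7 x7.
Proof. exact: (all_nthP node0 nodes7_ok 0 isT). Qed.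

Lemma x13_ok : node_ok (denominator 14 y13_terms) nodes13 x13.
Proof. exact: (all_nthP node0 nodes13_ok 0 isT). Qed.

Lemma rep7 : rep (denominator 8 y7_terms) (st x7) G7.
Proof.
have -> : st x7 = take 8 (times (denominator 8 y7_terms) y7_init) by vm_compute.
exact: rep_recseq.
Qed.

Lemma rep13 : rep (denominator 14 y13_terms) (st x13) G13.
Proof.
have -> : st x13 = take 14 (times (denominator 14 y13_terms) y13_init) by vm_compute.
exact: rep_recseq.
Qed.

Lemma G7_bound n m : G7 n m -> wt 1 1 m + 1 <= wt 1 1 n /\ wt 1 2 m + 1 <= wt 1 2 n.
Proof. exact: (@automaton_bound 8 y7_terms nodes7 isT nodes7_ok x7 G7 n m x7_ok rep7). Qed.

Lemma G13_bound n m : G13 n m -> wt 1 1 m + 1 <= wt 1 1 n /\ wt 1 2 m + 2 <= wt 1 2 n.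
Proof. exact: (@automaton_bound 14 y13_terms nodes13 isT nodes13_ok x13 G13 n m x13_ok rep13). Qed.

Lemma G7_lead n m a b : code n = (a.+1, b) -> code m = (a, b) -> G7 n m.
Proof.
by have [_] := @automaton_step 8 y7_terms nodes7 isT nodes7_ok x7 G7 n m a b x7_ok rep7; apply.
Qed.

Lemma G13_lead n m a b : code n = (a, b.+1) -> code m = (a, b) -> G13 n m.
Proof.
have [+ _] := @automaton_step 14 y13_terms nodes13 isT nodes13_ok x13 G13 n m a b x13_ok rep13.
exact.
Qed.

(** * Faithfulness *)

Local Open Scope ring_scope.

Definition basis5 n : S := D ^+ 5 * (D ^+ 6) ^+ n.
(** Lists stand for formal sums mod 2: repeated indices cancel in pairs, so only the parity of a
    multiplicity counts. *)
Definition sum5 (s : seq nat) : S := \sum_(n <- s) basis5 n.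
Definition supp (l : seq bool) := [seq m <- iota 0 (size l) | nth false l m].
Definition step (rows : nat -> seq bool) (s : seq nat) := flatten [seq supp (rows n) | n <- s].

Lemma mem_supp l m : (m \in supp l) = nth false l m.
Proof.
rewrite mem_filter mem_iota /= add0n; case: (ltnP m (size l)) => ml; rewrite ?andbT ?andbF //.
by rewrite nth_default.
Qed.

Lemma count_supp l m : count_mem m (supp l) = nth false l m.
Proof. by rewrite count_uniq_mem ?mem_supp // filter_uniq // iota_uniq. Qed.

Lemma ev1_supp (c y : S) l : c * ev1 y l = \sum_(m <- supp l) c * y ^+ m.
Proof.
elim: l c => [|b l IH] c; first by rewrite big_nil mulr0.
have -> : supp (b :: l) = (if b then [:: 0%N] else [::]) ++ map succn (supp l).
  by rewrite /supp /= -[1%N]/(0 + 1)%N -addn1 [in iota _ _]addnC iotaDl filter_map; case: b.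
rewrite big_cat big_map /= mulrDr mulrA IH; congr (_ + _).
  by case: b; rewrite ?big_seq1 ?big_nil ?mulr0.
by apply: eq_bigr => m _; rewrite -mulrA -exprS.
Qed.

Lemma T_sum5 p rows s :
  (forall n, T p (basis5 n) = D ^+ 5 * ev1 (D ^+ 6) (rows n)) ->
  T p (sum5 s) = sum5 (step rows s).
Proof.
move=> Trows; rewrite /sum5 (big_morph (T p) (TD p) (T0 p)) /step.
elim: s => [|n s IH]; first by rewrite !big_nil.
rewrite big_cons IH /= big_cat; congr (_ + _).
by rewrite Trows ev1_supp.
Qed.

Definition rows7 := recseq y7_terms y7_init.
Definition rows13 := recseq y13_terms y13_init.

Lemma T7_sum5 s : T 7 (sum5 s) = sum5 (step rows7 s).
Proof. exact/T_sum5/T7_y. Qed.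

Lemma T13_sum5 s : T 13 (sum5 s) = sum5 (step rows13 s).
Proof. exact/T_sum5/T13_y. Qed.

Lemma step_in rows s m : m \in step rows s -> exists2 n, n \in s & nth false (rows n) m.
Proof. by case/flatten_mapP => n ns; rewrite mem_supp; exists n. Qed.

Lemma odd_count_step rows s n0 m : (forall n, n \in s -> nth false (rows n) m = (n == n0)) ->
  odd (count_mem m (step rows s)) = odd (count_mem n0 s).
Proof.
elim: s => [//|n s IH] h; rewrite /step /= count_cat !oddD count_supp -/(step rows s) IH.
  by rewrite h ?mem_head.
by move=> k ks; apply: h; rewrite in_cons ks orbT.
Qed.

(** [h] and [g] are the starting weights, [i] and [k] the drops so far; adding the drops on the left
    avoids truncated subtraction. *)
Definition bounded h i g k (s : seq nat) :=
  forall n, n \in s -> (wt 1 1 n + i <= h)%N /\ (wt 1 2 n + k <= g)%N.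

Lemma bounded7 h i g k s : bounded h i g k s -> bounded h i.+1 g k.+1 (step rows7 s).
Proof.
by move=> b m /step_in[n /b[b1 b2] /G7_bound[g1 g2]]; split; clear -b1 b2 g1 g2; lia.
Qed.

Lemma bounded13 h i g k s : bounded h i g k s -> bounded h i.+1 g k.+2 (step rows13 s).
Proof.
by move=> b m /step_in[n /b[b1 b2] /G13_bound[g1 g2]]; split; clear -b1 b2 g1 g2; lia.
Qed.

Definition leading n0 (s : seq nat) :=
  bounded (wt 1 1 n0) 0 (wt 1 2 n0) 0 s /\ odd (count_mem n0 s).

(** The matrix with rows (1, 1) and (1, 2) is invertible. *)
Lemma code_wt n m : wt 1 1 n = wt 1 1 m -> wt 1 2 n = wt 1 2 m -> n = m.
Proof.
rewrite /wt => e1 e2; apply: code_inj.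
rewrite [LHS]surjective_pairing [RHS]surjective_pairing; congr pair; clear -e1 e2; lia.
Qed.

(** An index [k] of [s] that contributes to [m] has weights at least one above those of [m], that
    is, at least those of [n]; being bounded by these, it is [n]. *)
Lemma leading7 n m a b s : code n = (a.+1, b) -> code m = (a, b) ->
  leading n s -> leading m (step rows7 s).
Proof.
move=> cn cm [bs os]; have en : wt 1 1 n = (wt 1 1 m).+1 /\ wt 1 2 n = (wt 1 2 m).+1.
  by rewrite /wt cn cm /=; clear; lia.
split=> [k /(bounded7 bs)[h1 h2]|].
  by clear -h1 h2 en; lia.
rewrite (@odd_count_step _ _ n) // => k /bs[h1 h2].
apply/idP/eqP => [/G7_bound[g1 g2]|->]; last exact: G7_lead cn cm.
by apply: code_wt; clear -h1 h2 g1 g2 en; lia.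
Qed.

Lemma leading13 n m a b s : code n = (a, b.+1) -> code m = (a, b) ->
  leading n s -> leading m (step rows13 s).
Proof.
move=> cn cm [bs os]; have en : wt 1 1 n = (wt 1 1 m).+1 /\ wt 1 2 n = (wt 1 2 m).+2.
  by rewrite /wt cn cm /=; clear; lia.
split=> [k /(bounded13 bs)[h1 h2]|].
  by clear -h1 h2 en; lia.
rewrite (@odd_count_step _ _ n) // => k /bs[h1 h2].
apply/idP/eqP => [/G13_bound[g1 g2]|->]; last exact: G13_lead cn cm.
by apply: code_wt; clear -h1 h2 g1 g2 en; lia.
Qed.

Definition word i j s := iter i (step rows7) (iter j (step rows13) s).

Lemma word_sum5 i j s : iter i (T 7) (iter j (T 13) (sum5 s)) = sum5 (word i j s).
Proof.
have e j' : iter j' (T 13) (sum5 s) = sum5 (iter j' (step rows13) s).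
  by elim: j' => //= j' ->; rewrite T13_sum5.
by rewrite e /word; elim: i => //= i ->; rewrite T7_sum5.
Qed.

Lemma word_bounded i j n : 
  bounded (wt 1 1 n) (i + j) (wt 1 2 n) (i + j.*2) (word i j [:: n]).
Proof.
elim: i => [|i IH]; last exact: bounded7.
rewrite !add0n; elim: j => [|j IH]; last exact: bounded13.
by move=> m; rewrite inE => /eqP->; rewrite !addn0.
Qed.

Lemma word_leading i j n : code n = (i, j) -> leading 0 (word i j [:: n]).
Proof.
(* First T_13 lowers the second entry of the leading code from [j] to 0, then T_7 lowers the first
   from [i] to 0. *)
move=> cn; have l13 : forall k m, (k <= j)%N -> code m = (i, j - k)%N ->
    leading m (iter k (step rows13) [:: n]).
  elim=> [|k IH] m kj cm.
    have -> : m = n by apply: code_inj; rewrite cm cn subn0.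
    by split; [move=> k; rewrite inE => /eqP->; rewrite !addn0 | rewrite /= eqxx].
  have [m' cm'] := code_surj i (j - k).
  apply: (@leading13 m' m i (j - k.+1)) => //; last by apply: IH => //; lia.
  by rewrite cm'; congr pair; lia.
have l7 : forall k m, (k <= i)%N -> code m = (i - k, 0)%N -> leading m (word k j [:: n]).
  elim=> [|k IH] m ki cm; first by apply: l13; rewrite ?subnn // cm subn0.
  have [m' cm'] := code_surj (i - k) 0.
  apply: (@leading7 m' m (i - k.+1) 0) => //; last by apply: IH => //; lia.
  by rewrite cm'; congr pair; lia.
by apply: l7; rewrite ?subnn.
Qed.

Lemma sum5_leading0 s : leading 0 s -> sum5 s = D ^+ 5.
Proof.
case=> bs os; have /all_pred1P e : all (pred1 0%N) s.
  apply/allP => n /bs[h1 h2]; apply/eqP/code_wt; clear -h1 h2; move: h1 h2; rewrite /wt /=; lia.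
move: os; rewrite e count_nseq /= mul1n.
have sum_nseq k : sum5 (nseq k 0%N) = if odd k then D ^+ 5 else 0.
  elim: k => [|k IH]; first exact: big_nil.
  rewrite /sum5 big_cons -/(sum5 _) IH /basis5 expr0 mulr1 /=.
  by case: (odd k); [exact: S_addrr | exact: addr0].
by rewrite sum_nseq => ->.
Qed.

Lemma basis5_W5 n : W5 (basis5 n).
Proof.
exists (6 * n + 6)%N, (fun k => (k == 6 * n + 5)%N%:R).
have lt : (6 * n + 5 < 6 * n + 6)%N by lia.
rewrite (bigD1 (Ordinal lt)) /=; last by apply/andP; split; lia.
rewrite eqxx scale1r big1 ?addr0 => [|k /andP[_ ne]].
  by rewrite /basis5 -exprM -exprD addnC.
rewrite (_ : (k == 6 * n + 5 :> nat)%N = false) ?scale0r //.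
by apply/negbTE; move: ne; rewrite -val_eqE.
Qed.

Lemma ex_min_nat (P : nat -> Prop) : (exists n, P n) ->
  exists n, P n /\ forall m, P m -> (n <= m)%N.
Proof.
move=> [n0 Pn0]; have ex : exists n, `[< P n >] by exists n0; apply/asboolP.
exists (ex_minn ex); case: ex_minnP => n /asboolP Pn nmin; split=> // m Pm.
exact/nmin/asboolP.
Qed.

Theorem theorem4p15 (u : fps2) :
  (forall w : fps 'F_2, W5 w -> act u w = 0) -> u = 0.
Proof.
move=> uW; apply: contrapT => u0.
have [h [[i0 [j0 [ijh uij]]] hmin]] : exists h, (exists i j, (i + j = h)%N /\ u i j <> 0) /\
    forall m, (exists i j, (i + j = m)%N /\ u i j <> 0) -> (h <= m)%N.
  apply: ex_min_nat; apply: contrapT => nex; apply: u0.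
  apply: fps_ext => i; apply: fps_ext => j; apply: contrapT => uij; apply: nex.
  by exists (i + j)%N, i, j.
have [j [[jh uj] jmin]] : exists j, ((j <= h)%N /\ u (h - j)%N j <> 0) /\
    forall k, (k <= h)%N /\ u (h - k)%N k <> 0 -> (j <= k)%N.
  apply: ex_min_nat; exists j0; rewrite -ijh addnK; split=> //; exact: leq_addl.
pose i := (h - j)%N; have [n cn] := code_surj i j.
have := uW _ (basis5_W5 n).
have b1 : basis5 n = sum5 [:: n] by rewrite /sum5 big_seq1.
rewrite /act -(@fsbig_widen _ _ _ _ [set (i, j)]) //; last first.
  case=> k l [_ kl] /=; case: (pselect (u k l = 0)) => [->|ukl]; first exact: scale0r.
  rewrite b1 word_sum5; suff -> : word k l [:: n] = [::] by rewrite /sum5 big_nil scaler0.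
  (* A remaining index would force k + l <= i + j and k + 2l <= i + 2j. Minimality of [h] makes the
     first an equality; then minimality of [j] gives l > j, against the second. *)
  have := @word_bounded k l n; case: (word k l [:: n]) => // m s /(_ m (mem_head _ _))[].
  have hkl : (h <= k + l)%N by apply: hmin; exists k, l.
  have jl : (k + l = h)%N -> (j < l)%N.
    move=> kl'; rewrite ltn_neqAle jmin; last by rewrite -kl' addnK; split=> //; exact: leq_addl.
    rewrite andbT; apply/eqP => jl; apply: kl; congr pair => //.
    by rewrite /i jl -kl' addnK.
  rewrite /wt cn /= /i; clear -hkl jl jh; lia.
rewrite fsbig_set1 /= b1 word_sum5 sum5_leading0; last exact: word_leading.
case: (F2_cases (u i j)) => [//|->]; rewrite scale1r => D5.
by have := D_pow_lead 5; rewrite D5 => /esym/eqP; rewrite oner_eq0.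
Qed.
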